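(* Let $\sigma>0$, $\mu\ge0$ be constants. There exists a constant $\gamma\ge0$ such that for every $(f,g)\in X$ and every $d\in\Phi(f,g)$ the corresponding solution $u$ satisfies $$\limsup_{t\to+\infty}\|u[t]\|_2\le\gamma\,\sup_{t\ge0}|d(t)|.$$ Moreover, the constant $\gamma\ge0$ satisfies $\gamma\le G(\mu,\sigma)$ (that is, such a $\gamma$ exists with $\gamma\le G(\mu,\sigma)$), where $$G(\mu,\sigma):=\begin{cases}\dfrac1{\sqrt3}&\text{if }\mu\sigma\ge1,\\[2mm]\dfrac1\pi\sqrt{2\displaystyle\sum_{n=1}^\infty n^{-2}A_n^2}&\text{if }0\le\mu\sigma<1,\end{cases}$$ and, for integers $n\geq 1$, $A_n$ is given by the following formulas: (i) if $\mu+n^2\pi^2\sigma>2n\pi\ge2\sigma^{-1}$, $$A_n=1+2\sqrt{1-\mu\sigma}\left(\frac{2\beta_n\sqrt{1-\mu\sigma}}{\sigma(\mu+n^2\pi^2\sigma)(1+\beta_n)-2\beta_n}\right)^{\beta_n},\qquad \beta_n:=\frac{\mu+n^2\pi^2\sigma}{\sqrt{(\mu+n^2\pi^2\sigma)^2-4n^2\pi^2}};$$ (ii) if $n\pi\sigma<1$ and $\mu+n^2\pi^2\sigma\ge2n\pi$, $A_n=1$; (iii) if $n\pi\sigma=1+\sqrt{1-\mu\sigma}$, $$A_n=1+2\sqrt{1-\mu\sigma}\,\exp\left(-1-\frac1{\sqrt{1-\mu\sigma}}\right);$$ (iv) if $\mu+n^2\pi^2\sigma<2n\pi$, $$A_n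=1+2\sqrt{1-\sigma\mu}\;\frac{\exp\left(\dfrac{\mu+n^2\pi^2\sigma}{\sqrt{4n^2\pi^2-(\mu+n^2\pi^2\sigma)^2}}\arccos\left(\dfrac{2-\sigma\mu-n^2\pi^2\sigma^2}{2\sqrt{1-\sigma\mu}}\right)\right)}{\exp\left(\dfrac{(\mu+n^2\pi^2\sigma)\pi}{\sqrt{4n^2\pi^2-(\mu+n^2\pi^2\sigma)^2}}\right)-1}.$$
   Context: For constants $\sigma>0$, $\mu\ge0$ consider the wave equation with Kelvin-Voigt and viscous damping $$\frac{\partial^2 u}{\partial t^2}(t,x)=\frac{\partial^2 u}{\partial x^2}(t,x)+\sigma\frac{\partial^3 u}{\partial t\,\partial x^2}(t,x)-\mu\frac{\partial u}{\partial t}(t,x),\quad (t,x)\in(0,+\infty)\times(0,1),$$ $$u(t,0)=d(t),\quad u(t,1)=0,\quad t\ge0,$$ with initial conditions $u[0]=f$, $\frac{\partial u}{\partial t}[0]=g$. Here $u[t]$ denotes the profile $x\mapsto u(t,x)$ (and similarly $\frac{\partial u}{\partial t}[t]$), the term $\frac{\partial^3u}{\partial t\,\partial x^2}$ is the second $x$-derivative of $\frac{\partial u}{\partial t}$, and $\mathbb{R}_+=[0,+\infty)$. $\|v\|_2=\left(\int_0^1|v(x)|^2dx\right)^{1/2}$. A solution means a function $u\in C^2(\mathbb{R}_+\times[0,1])$ with $\frac{\partial u}{\partial t}[t]\in C^2([0,1])$ for all $t\ge0$ satisfying the initial-boundary value problem consisting of the differential equation $\frac{\partial^2 u}{\partial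 t^2}(t,x)=\frac{\partial^2 u}{\partial x^2}(t,x)+\sigma\frac{\partial^3 u}{\partial t\,\partial x^2}(t,x)-\mu\frac{\partial u}{\partial t}(t,x)$ for $(t,x)\in(0,+\infty)\times(0,1)$, the boundary conditions $u(t,0)=d(t)$, $u(t,1)=0$ for $t\ge0$, and the initial conditions $u[0]=f$, $\frac{\partial u}{\partial t}[0]=g$. $X$ is the set of all $(f,g)\in C^2([0,1])\times C^2([0,1])$ for which there exists a bounded $d\in C^2(\mathbb{R}_+)$ such that the initial-boundary value problem has a unique solution. For $(f,g)\in X$, $\Phi(f,g)$ is the set of bounded $d\in C^2(\mathbb{R}_+)$ for which the initial-boundary value problem with data $f,g,d$ has a unique solution. The numbers $A_n$ are used only in the case $0\le\mu\sigma<1$. *)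

(* Defs.v *)
From Stdlib Require Import Reals Lra ClassicalEpsilon.
From Coquelicot Require Import Coquelicot.
Open Scope R_scope.

(** Functions on [[0,1]], [[0,+oo)] and [[0,+oo) x [0,1]] are represented by
    total functions on [R] (resp. [R -> R -> R], time first); every notion below
    depends only on their values on the indicated set. *)

Definition unit_interval (x : R) : Prop := 0 <= x <= 1.

Definition half_line (t : R) : Prop := 0 <= t.

Definition strip (p : R * R) : Prop := half_line (fst p) /\ unit_interval (snd p).

(** [is_derive] with [locally x] replaced by its trace on [D], hence a one-sided
    derivative at an endpoint of the interval [D]. *)
Definition is_derive_on (D : R -> Prop) (f : R -> R) (x l : R) : Prop :=
  filterdiff f (within D (locally x)) (fun y => scal y l).

Definition C2_on (D : R -> Prop) (f : R -> R) : Prop :=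
  exists f1 f2 : R -> R,
    (forall x, D x -> is_derive_on D f x (f1 x)) /\
    (forall x, D x -> is_derive_on D f1 x (f2 x)) /\
    continuous_on D f2.

Definition is_Dt (v vt : R -> R -> R) : Prop :=
  forall t x, strip (t, x) -> is_derive_on half_line (fun s => v s x) t (vt t x).

Definition is_Dx (v vx : R -> R -> R) : Prop :=
  forall t x, strip (t, x) -> is_derive_on unit_interval (v t) x (vx t x).

Definition C0_strip (v : R -> R -> R) : Prop :=
  continuous_on strip (fun p => v (fst p) (snd p)).

Definition C1_strip (v : R -> R -> R) : Prop :=
  C0_strip v /\
  exists vt vx : R -> R -> R,
    is_Dt v vt /\ is_Dx v vx /\ C0_strip vt /\ C0_strip vx.

Definition C2_strip (v : R -> R -> R) : Prop :=
  C0_strip v /\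
  exists vt vx : R -> R -> R,
    is_Dt v vt /\ is_Dx v vx /\ C1_strip vt /\ C1_strip vx.

(** The differential equation is only required at interior points, where
    [Derive] and [Derive_n] are the derivatives whose existence is guaranteed by
    the regularity requirements of [is_solution]. *)
Definition wave_equation (sigma mu : R) (u : R -> R -> R) : Prop :=
  forall t x, 0 < t -> 0 < x < 1 ->
    Derive_n (fun s => u s x) 2 t =
      Derive_n (fun y => u t y) 2 x
      + sigma * Derive_n (fun y => Derive (fun s => u s y) t) 2 x
      - mu * Derive (fun s => u s x) t.

Definition is_solution (sigma mu : R) (f g d : R -> R) (u : R -> R -> R) : Prop :=
  C2_strip u /\
  (exists ut : R -> R -> R,
     is_Dt u ut /\
     (forall t, 0 <= t -> C2_on unit_interval (ut t)) /\
     (forall x, 0 <= x <= 1 -> ut 0 x = g x)) /\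
  (forall x, 0 <= x <= 1 -> u 0 x = f x) /\
  wave_equation sigma mu u /\
  (forall t, 0 <= t -> u t 0 = d t) /\
  (forall t, 0 <= t -> u t 1 = 0).

Definition has_unique_solution (sigma mu : R) (f g d : R -> R) : Prop :=
  exists u, is_solution sigma mu f g d u /\
    forall v, is_solution sigma mu f g d v ->
      forall t x, strip (t, x) -> v t x = u t x.

Definition admissible_input (d : R -> R) : Prop :=
  C2_on half_line d /\ exists M, forall t, 0 <= t -> Rabs (d t) <= M.

Definition X_set (sigma mu : R) (f g : R -> R) : Prop :=
  C2_on unit_interval f /\ C2_on unit_interval g /\
  exists d, admissible_input d /\ has_unique_solution sigma mu f g d.

Definition Phi_set (sigma mu : R) (f g d : R -> R) : Prop :=
  admissible_input d /\ has_unique_solution sigma mu f g d.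

Definition norm2 (v : R -> R) : R := sqrt (RInt (fun x => Rabs (v x) ^ 2) 0 1).

Definition sup_half_line (f : R -> R) : Rbar :=
  Lub_Rbar (fun z => exists t, 0 <= t /\ z = f t).

Definition limsup_pinfty (f : R -> R) : Rbar :=
  Rbar_glb (fun y => exists T, 0 <= T /\
                     y = Lub_Rbar (fun z => exists t, T <= t /\ z = f t)).

Definition damping (mu sigma : R) (n : nat) : R :=
  mu + INR n ^ 2 * PI ^ 2 * sigma.

Definition beta (mu sigma : R) (n : nat) : R :=
  damping mu sigma n / sqrt (damping mu sigma n ^ 2 - 4 * INR n ^ 2 * PI ^ 2).

(** For [0 < sigma], [0 <= mu], [mu * sigma < 1] and [1 <= n], exactly one of the
    four conditions holds (see [A_cases]), so the last branch is never reached. *)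
Definition A (mu sigma : R) (n : nat) : R :=
  let a := damping mu sigma n in
  let b := beta mu sigma n in
  let npi := INR n * PI in
  if excluded_middle_informative (a > 2 * npi /\ 2 * npi >= 2 * / sigma) then
    1 + 2 * sqrt (1 - mu * sigma)
        * Rpower (2 * b * sqrt (1 - mu * sigma) / (sigma * a * (1 + b) - 2 * b)) b
  else if excluded_middle_informative (npi * sigma < 1 /\ a >= 2 * npi) then
    1
  else if excluded_middle_informative (npi * sigma = 1 + sqrt (1 - mu * sigma)) then
    1 + 2 * sqrt (1 - mu * sigma) * exp (- 1 - 1 / sqrt (1 - mu * sigma))
  else if excluded_middle_informative (a < 2 * npi) then
    1 + 2 * sqrt (1 - sigma * mu)
        * (exp (a / sqrt (4 * npi ^ 2 - a ^ 2)
                * acos ((2 - sigma * mu - npi ^ 2 * sigma ^ 2)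
                        / (2 * sqrt (1 - sigma * mu))))
           / (exp (a * PI / sqrt (4 * npi ^ 2 - a ^ 2)) - 1))
  else 0.

Lemma A_cases (mu sigma : R) (n : nat) :
  0 < sigma -> 0 <= mu -> mu * sigma < 1 -> (1 <= n)%nat ->
  let a := damping mu sigma n in
  let npi := INR n * PI in
  let ci := a > 2 * npi /\ 2 * npi >= 2 * / sigma in
  let cii := npi * sigma < 1 /\ a >= 2 * npi in
  let ciii := npi * sigma = 1 + sqrt (1 - mu * sigma) in
  let civ := a < 2 * npi in
  (ci \/ cii \/ ciii \/ civ) /\
  ~ (ci /\ cii) /\ ~ (ci /\ ciii) /\ ~ (ci /\ civ) /\
  ~ (cii /\ ciii) /\ ~ (cii /\ civ) /\ ~ (ciii /\ civ).
Proof.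
  intros Hs Hm Hms Hn a npi ci cii ciii civ.
  assert (Ha : sigma * (a - 2 * npi) = (npi * sigma - 1) ^ 2 - (1 - mu * sigma)).
  { unfold a, npi, damping; ring. }
  assert (Hq : sqrt (1 - mu * sigma) ^ 2 = 1 - mu * sigma).
  { apply pow2_sqrt; lra. }
  assert (Hq0 : 0 < sqrt (1 - mu * sigma)) by (apply sqrt_lt_R0; lra).
  assert (Hi : 2 * npi >= 2 * / sigma <-> npi * sigma >= 1).
  { assert (sigma * / sigma = 1) by (field; lra).
    assert (0 < / sigma) by (apply Rinv_0_lt_compat; lra).
    split; intro; nra. }
  assert (H3 : ciii -> a = 2 * npi).
  { unfold ciii; intro H; rewrite H in Ha.
    assert (sigma * (a - 2 * npi) = 0) by (rewrite Ha; nra). nra. }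
  assert (H3' : a = 2 * npi -> npi * sigma >= 1 -> ciii).
  { unfold ciii; intros H H1.
    assert ((npi * sigma - 1 - sqrt (1 - mu * sigma))
            * (npi * sigma - 1 + sqrt (1 - mu * sigma)) = 0).
    { replace (a - 2 * npi) with 0 in Ha by lra. nra. }
    nra. }
  split.
  - destruct (Rlt_dec a (2 * npi)) as [H|H]; [tauto|].
    destruct (Rlt_dec (npi * sigma) 1) as [H1|H1].
    + right; left; split; lra.
    + destruct (Rlt_dec (2 * npi) a) as [H2|H2].
      * left; split; [lra|]. apply Hi; lra.
      * right; right; left. apply H3'; lra.
  - unfold ci, cii, civ.
    split; [intros [[_ H1] [H2 _]]; apply Hi in H1; lra|].
    split; [intros [[H1 _] H2]; apply H3 in H2; lra|].
    split; [intros [[H1 _] H2]; lra|].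
    split; [intros [[H1 _] H2]; unfold ciii in H2; lra|].
    split; [intros [[_ H1] H2]; lra|].
    intros [H1 H2]; apply H3 in H1; lra.
Qed.

Definition G (mu sigma : R) : R :=
  if Rle_dec 1 (mu * sigma) then 1 / sqrt 3
  else 1 / PI * sqrt (2 * Series (fun k => / INR (S k) ^ 2 * A mu sigma (S k) ^ 2)).

(* Main.v *)
Require Import Defs.
From Stdlib Require Import Reals Lra Lia Psatz ClassicalEpsilon.
From Coquelicot Require Import Coquelicot.
Open Scope R_scope.

(** Testing the equation against [sin (n PI x)] and integrating by parts turns the
    [n]-th sine coefficient [y] of [u[t]] into a solution of
    [y'' + a y' + w^2 y = w (d + sigma d')] with [w = n PI] and [a = mu + w^2 sigma].
    By Duhamel's formula [limsup |y| <= ||h||_1 sup |d|], where [h = w (K + sigma K')]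
    is built from the fundamental solution [K]; locating the sign changes of [h] gives
    [||h||_1 <= A_n / w] in each damping regime.  For large [n] the modes are bounded by
    [C / n] uniformly in time, so the limsup may be taken inside
    [||u[t]||_2^2 <= 2 sum y_n^2], and [2 sum (A_n / w)^2 <= G^2].
    The two halves of Parseval used here are limits of the exact Parseval identity for
    the discrete sine transform. *)

(** * Discrete sine transform *)


(* Sums produced by [sum_n] live in the carrier of a canonical structure, which hides
   the type [R] from [ring] and [field]. *)
Ltac real_eq := match goal with |- @eq _ ?a ?b => change (@eq R a b) end.

(** Only [sup |d|] is available, never a bound on [d'], so the derivative of the input has to be
    moved onto the kernel; this is why [h] contains [K']. The integral of [h] over the half line is
    [1 / w], the steady response to a constant input, and each sign change of [h] adds twice the
    absolute value, at that point, of its primitive vanishing at infinity. There this primitive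
    carries the factor [1 - a sigma + w^2 sigma^2 = 1 - mu sigma], the rescaled characteristic
    polynomial at [-1 / sigma], which does not depend on [n]; the recurring [sqrt (1 - mu sigma)]
    stems from it. For real decay rates, their position relative to [1 / sigma] decides whether [h]
    changes sign at all, which explains the threshold [mu sigma = 1] and the side conditions of the
    cases. The equation and two-sided time derivatives are available at positive times only, so
    Duhamel starts at time [1]. The state reached there dies out in each mode, but not at a common
    rate known in advance; the tail of the sum over modes therefore needs its own bound. *)

Lemma sum_n_Rplus (f g : nat -> R) (N : nat) :
  sum_n (fun k => f k + g k) N = sum_n f N + sum_n g N.
Proof. exact (sum_n_plus f g N). Qed.

Lemma sum_n_Rmult_l (c : R) (f : nat -> R) (N : nat) :
  sum_n (fun k => c * f k) N = c * sum_n f N.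
Proof. exact (sum_n_mult_l (K := R_Ring) c f N). Qed.

Lemma sum_n_O (f : nat -> R) : sum_n f 0 = f 0%nat.
Proof. exact (sum_O f). Qed.

Lemma sum_n_S (f : nat -> R) (N : nat) : sum_n f (S N) = sum_n f N + f (S N).
Proof. exact (sum_Sn f N). Qed.

Lemma sum_n_Rext_loc (f g : nat -> R) (N : nat) :
  (forall k, (k <= N)%nat -> f k = g k) -> sum_n f N = sum_n g N.
Proof. exact (sum_n_ext_loc f g N). Qed.

Lemma sum_n_Rext (f g : nat -> R) (N : nat) :
  (forall k, f k = g k) -> sum_n f N = sum_n g N.
Proof. exact (sum_n_ext f g N). Qed.

(** Each product [2 sin (t / 2) cos (n t)] is the difference of the sines of [(n + 1/2) t] and
    [(n - 1/2) t]. Writing the last angle as [(N + 1) t - t / 2] makes [(N + 1) t] a multiple of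
    [PI] on the grids used below. *)
Lemma sum_cos_telescope (t : R) (N : nat) :
  2 * sin (t / 2) * sum_n (fun n => cos (INR n * t)) N
  = sin (INR (S N) * t - t / 2) + sin (t / 2).
Proof.
  induction N as [|N IH].
  - rewrite sum_n_O. change (INR 1) with 1. change (INR 0) with 0.
    replace (1 * t - t / 2) with (t / 2) by field.
    rewrite Rmult_0_l, cos_0. ring.
  - rewrite sum_n_S, Rmult_plus_distr_l, IH.
    replace (INR (S (S N)) * t - t / 2) with (INR (S N) * t + t / 2)
      by (rewrite (S_INR (S N)); field).
    rewrite sin_plus, sin_minus. ring.
Qed.

Lemma sin_INR_PI (m : nat) : sin (INR m * PI) = 0.
Proof.
  apply sin_eq_0_1. exists (Z.of_nat m). now rewrite <- INR_IZR_INZ.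
Qed.

Lemma cos_INR_PI (m : nat) : cos (INR m * PI) = (-1) ^ m.
Proof.
  induction m as [|m IH].
  - simpl. rewrite Rmult_0_l. apply cos_0.
  - rewrite S_INR, Rmult_plus_distr_r, Rmult_1_l, neg_cos, IH. simpl. ring.
Qed.

(** The range of [m] keeps [t / 2] strictly between [0] and [PI], so that [sin (t / 2)] can be
    cancelled. The value depends only on the parity of [m], which is what orthogonality rests on. *)
Lemma sum_cos_equidistant (M m : nat) :
  (0 < m < 2 * S M)%nat ->
  sum_n (fun n => cos (INR n * (INR m * PI / INR (S M)))) M
  = (1 - (-1) ^ m) / 2.
Proof.
  intros Hm.
  assert (HM : 0 < INR (S M)) by (apply lt_0_INR; lia).
  set (t := INR m * PI / INR (S M)).
  assert (Hs : 0 < sin (t / 2)).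
  { pose proof PI_RGT_0.
    assert (0 < INR m) by (apply lt_0_INR; lia).
    assert (INR m < 2 * INR (S M)).
    { replace 2 with (INR 2) by reflexivity. rewrite <- mult_INR. apply lt_INR. lia. }
    apply sin_gt_0.
    - unfold t. apply Rdiv_lt_0_compat; [|lra]. apply Rdiv_lt_0_compat; nra.
    - apply (Rmult_lt_reg_r (2 * INR (S M))); [lra|].
      replace (t / 2 * (2 * INR (S M))) with (INR m * PI) by (unfold t; field; lra).
      nra. }
  pose proof (sum_cos_telescope t M) as H.
  replace (INR (S M) * t) with (INR m * PI) in H by (unfold t; field; lra).
  rewrite sin_minus, sin_INR_PI, cos_INR_PI in H.
  apply (Rmult_eq_reg_l (2 * sin (t / 2))); [|lra].
  rewrite H. field.
Qed.

Lemma sin_orthogonal_discrete (M j k : nat) :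
  (j < k <= M)%nat ->
  sum_n (fun n => sin (INR n * (INR j * PI / INR (S M)))
                * sin (INR n * (INR k * PI / INR (S M)))) M = 0.
Proof.
  intros Hjk.
  assert (HM : 0 < INR (S M)) by (apply lt_0_INR; lia).
  transitivity (sum_n (fun n =>
      1 / 2 * cos (INR n * (INR (k - j) * PI / INR (S M)))
      + - (1 / 2) * cos (INR n * (INR (k + j) * PI / INR (S M)))) M).
  - apply sum_n_Rext. intros n.
    rewrite minus_INR, plus_INR by lia.
    replace (INR n * ((INR k - INR j) * PI / INR (S M))) with
      (INR n * (INR k * PI / INR (S M)) - INR n * (INR j * PI / INR (S M)))
      by (field; lra).
    replace (INR n * ((INR k + INR j) * PI / INR (S M))) with
      (INR n * (INR k * PI / INR (S M)) + INR n * (INR j * PI / INR (S M)))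
      by (field; lra).
    rewrite cos_minus, cos_plus. field.
  - rewrite sum_n_Rplus, !sum_n_Rmult_l, !sum_cos_equidistant by lia.
    (* [k - j] and [k + j] have the same parity, so the two cosine sums are equal and cancel. *)
    replace (k + j)%nat with ((k - j) + 2 * j)%nat by lia.
    rewrite pow_add, pow_1_even. lra.
Qed.

Lemma sin_norm_discrete (M j : nat) :
  (0 < j <= M)%nat ->
  sum_n (fun n => sin (INR n * (INR j * PI / INR (S M))) ^ 2) M = INR (S M) / 2.
Proof.
  intros Hj.
  assert (HM : 0 < INR (S M)) by (apply lt_0_INR; lia).
  transitivity (sum_n (fun n => 1 / 2 +
      - (1 / 2) * cos (INR n * (INR (2 * j) * PI / INR (S M)))) M).
  - apply sum_n_Rext. intros n.
    rewrite mult_INR. change (INR 2) with 2.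
    replace (INR n * (2 * INR j * PI / INR (S M)))
      with (2 * (INR n * (INR j * PI / INR (S M)))) by (field; lra).
    rewrite cos_2a_sin. field.
  - rewrite sum_n_Rplus, sum_n_Rmult_l, sum_cos_equidistant, sum_n_const by lia.
    rewrite pow_1_even. lra.
Qed.

(** The cutoff [J] is separated from the grid size so that induction can add one column of the sine
    matrix at a time: orthogonality removes the cross terms. The column [j = 0] is zero, whence the
    subtraction of [f 0 ^ 2]. *)
Lemma discrete_parseval_aux (M : nat) (f : nat -> R) (J : nat) :
  (J <= M)%nat ->
  sum_n (fun n => sum_n (fun j => f j * sin (INR n * (INR j * PI / INR (S M)))) J ^ 2) M
  = INR (S M) / 2 * (sum_n (fun j => f j ^ 2) J - f 0%nat ^ 2).
Proof.
  induction J as [|J IH]; intros HJ.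
  - rewrite sum_n_O. transitivity (sum_n (fun _ : nat => 0) M).
    + apply sum_n_Rext; intros n. rewrite sum_n_O. change (INR 0) with 0.
      replace (INR n * (0 * PI / INR (S M))) with 0 by (unfold Rdiv; ring).
      rewrite sin_0. ring.
    + rewrite sum_n_const. real_eq. ring.
  - set (s := fun n j => sin (INR n * (INR j * PI / INR (S M)))) in *.
    transitivity (sum_n (fun n =>
       sum_n (fun j => f j * s n j) J ^ 2
       + (2 * f (S J) * sum_n (fun j => f j * (s n j * s n (S J))) J
          + f (S J) ^ 2 * s n (S J) ^ 2)) M).
    + apply sum_n_Rext; intros n. rewrite sum_n_S. fold (s n (S J)).
      rewrite (sum_n_Rext (fun j => f j * (s n j * s n (S J)))
                 (fun j => s n (S J) * (f j * s n j)) J)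
        by (intros; ring).
      rewrite sum_n_Rmult_l. unfold s. ring.
    + assert (Hcross : sum_n (fun n => sum_n (fun j => f j * (s n j * s n (S J))) J) M = 0).
      { rewrite (sum_n_switch (G := R_AbelianGroup)).
        rewrite (sum_n_Rext_loc _ (fun _ => 0) J).
        - rewrite sum_n_const. real_eq. ring.
        - intros j Hj. rewrite sum_n_Rmult_l. unfold s.
          rewrite sin_orthogonal_discrete by lia. ring. }
      rewrite !sum_n_Rplus, !sum_n_Rmult_l, Hcross. unfold s. rewrite (IH ltac:(lia)).
      rewrite sin_norm_discrete by lia. rewrite sum_n_S. real_eq. field.
Qed.

(** The left Riemann sum of the [n]-th sine coefficient with [S M] cells, so that the grid is never
    empty. *)
Definition dst (f : R -> R) (M n : nat) : R :=
  / INR (S M) * sum_n (fun j => f (INR j / INR (S M))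
                     * sin (INR n * PI * (INR j / INR (S M)))) M.

Lemma discrete_parseval (f : R -> R) (M : nat) :
  2 * sum_n (fun n => dst f M n ^ 2) M
  = / INR (S M) * sum_n (fun j => f (INR j / INR (S M)) ^ 2) M - f 0 ^ 2 / INR (S M).
Proof.
  assert (HM : 0 < INR (S M)) by (apply lt_0_INR; lia).
  pose proof (discrete_parseval_aux M (fun j => f (INR j / INR (S M))) M ltac:(lia)) as H.
  cbv beta in H. change (INR 0) with 0 in H.
  replace (0 / INR (S M)) with 0 in H by (unfold Rdiv; ring).
  rewrite (sum_n_Rext _ (fun n => (/ INR (S M)) ^ 2 *
     (sum_n (fun j => f (INR j / INR (S M)) * sin (INR n * (INR j * PI / INR (S M)))) M ^ 2))).
  2:{ intros n. unfold dst.
      rewrite (sum_n_Rext (fun j => f (INR j / INR (S M)) * sin (INR n * PI * (INR j / INR (S M))))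
         (fun j => f (INR j / INR (S M)) * sin (INR n * (INR j * PI / INR (S M))))).
      2:{ intros j. f_equal. f_equal. field. lra. }
      ring. }
  rewrite sum_n_Rmult_l, H. field. lra.
Qed.

(** * Decay of the discrete coefficients, uniform in the grid *)

Lemma sin_ge_quarter (x : R) : 0 <= x <= PI / 2 -> x / 4 <= sin x.
Proof.
  intros Hx. pose proof PI_4.
  destruct (SIN x) as [H1 _]; [lra..|].
  assert (E : sin_lb x = x - x ^ 3 / 6 + x ^ 5 / 120 - x ^ 7 / 5040).
  { unfold sin_lb, sin_approx, sin_term. simpl. field. }
  rewrite E in H1.
  assert (H2 : x ^ 2 <= 4) by nra.
  assert (H3 : x ^ 3 <= 4 * x).
  { replace (x ^ 3) with (x ^ 2 * x) by ring. apply Rmult_le_compat_r; lra. }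
  assert (H5 : 0 <= x ^ 5) by (apply pow_le; lra).
  assert (H7 : x ^ 7 <= 4 * x ^ 5).
  { replace (x ^ 7) with (x ^ 2 * x ^ 5) by ring. apply Rmult_le_compat_r; lra. }
  lra.
Qed.

(** The boundary term [g J * c (S J)] is kept inside the absolute value: the induction step then
    adds only [(g (S J) - g J) * c (S J)]. *)
Lemma summation_by_parts_bound (g c : nat -> R) (F delta : R) (J : nat) :
  (forall j, Rabs (c j) <= 1) ->
  Rabs (g 0%nat) <= F ->
  (forall j, (j < J)%nat -> Rabs (g (S j) - g j) <= delta) ->
  Rabs (sum_n (fun j => g j * (c j - c (S j))) J + g J * c (S J)) <= F + INR J * delta.
Proof.
  intros Hc H0. induction J as [|J IH]; intros Hg.
  - rewrite sum_n_O. change (INR 0) with 0.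
    replace (g 0%nat * (c 0%nat - c 1%nat) + g 0%nat * c 1%nat) with (g 0%nat * c 0%nat) by ring.
    rewrite Rabs_mult. pose proof (Hc 0%nat). pose proof (Rabs_pos (c 0%nat)).
    pose proof (Rabs_pos (g 0%nat)). nra.
  - rewrite sum_n_S, S_INR.
    replace (sum_n (fun j => g j * (c j - c (S j))) J
             + g (S J) * (c (S J) - c (S (S J))) + g (S J) * c (S (S J)))
      with ((sum_n (fun j => g j * (c j - c (S j))) J + g J * c (S J))
            + (g (S J) - g J) * c (S J)) by ring.
    eapply Rle_trans; [apply Rabs_triang|]. rewrite Rabs_mult.
    assert (IH' := IH ltac:(intros; apply Hg; lia)).
    assert (H1 := Hg J ltac:(lia)). pose proof (Hc (S J)).
    pose proof (Rabs_pos (c (S J))). pose proof (Rabs_pos (g (S J) - g J)). nra.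
Qed.

Definition lipschitz_unit (f : R -> R) (L : R) : Prop :=
  forall x y, 0 <= x <= 1 -> 0 <= y <= 1 -> Rabs (f x - f y) <= L * Rabs (x - y).

Lemma grid_unit (M j : nat) : (j <= S M)%nat -> 0 <= INR j / INR (S M) <= 1.
Proof.
  intros Hj. assert (HM : 0 < INR (S M)) by (apply lt_0_INR; lia).
  apply le_INR in Hj. pose proof (pos_INR j). split.
  - apply Rdiv_le_0_compat; lra.
  - apply (Rmult_le_reg_r (INR (S M))); [lra|].
    unfold Rdiv. rewrite Rmult_assoc, Rinv_l; lra.
Qed.

(** Multiplication by [2 sin (t / 2)] turns the sines into differences of cosines at half steps, and
    summation by parts moves the difference onto [f], whose variation over the grid is at most [L].
    Since [n <= M], [t / 2] stays in [[0, PI / 2]], where the sine is at least of order [n / S M].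
    The bound is independent of [M], as the exchange of limits in Parseval demands. *)
Lemma dst_bound (f : R -> R) (F L : R) (M n : nat) :
  (forall x, 0 <= x <= 1 -> Rabs (f x) <= F) -> lipschitz_unit f L ->
  (1 <= n <= M)%nat -> Rabs (dst f M n) <= 2 * (2 * F + L) / INR n.
Proof.
  intros HF HL Hn.
  assert (HM : 0 < INR (S M)) by (apply lt_0_INR; lia).
  assert (Hn0 : 0 < INR n) by (apply lt_0_INR; lia).
  assert (HnM : INR n <= INR (S M)) by (apply le_INR; lia).
  pose proof PI_RGT_0. pose proof PI2_3_2.
  set (t := INR n * PI / INR (S M)).
  set (S0 := sum_n (fun j => f (INR j / INR (S M)) * sin (INR n * PI * (INR j / INR (S M)))) M).
  assert (Hs : INR n / (4 * INR (S M)) <= sin (t / 2)).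
  { eapply Rle_trans; [|apply sin_ge_quarter]; unfold t.
    - apply (Rmult_le_reg_r (8 * INR (S M))); [lra|]. field_simplify; nra.
    - split; [repeat apply Rdiv_le_0_compat; nra|].
      apply (Rmult_le_reg_r (2 * INR (S M))); [lra|]. field_simplify; nra. }
  assert (HL0 : 0 <= L).
  { pose proof (HL 0 1 ltac:(lra) ltac:(lra)) as H1.
    replace (0 - 1) with (- (1)) in H1 by ring. rewrite Rabs_Ropp, Rabs_R1 in H1.
    pose proof (Rabs_pos (f 0 - f 1)). lra. }
  assert (HB : Rabs (2 * sin (t / 2) * S0) <= 2 * F + L).
  { pose (c := fun j => cos (INR j * t - t / 2)).
    assert (E : 2 * sin (t / 2) * S0
                = sum_n (fun j => f (INR j / INR (S M)) * (c j - c (S j))) M).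
    { unfold S0. rewrite <- sum_n_Rmult_l. apply sum_n_Rext. intros j. unfold c.
      replace (INR (S j) * t - t / 2) with (INR j * t + t / 2) by (rewrite S_INR; field).
      replace (INR n * PI * (INR j / INR (S M))) with (INR j * t) by (unfold t; field; lra).
      rewrite cos_plus, cos_minus. ring. }
    assert (B := summation_by_parts_bound (fun j => f (INR j / INR (S M))) c F
                   (L / INR (S M)) M).
    cbv beta in B. rewrite E.
    assert (Hc : forall j, Rabs (c j) <= 1).
    { intros j. apply Rabs_le. unfold c. apply COS_bound. }
    specialize (B Hc).
    specialize (B (HF _ (grid_unit M 0 ltac:(lia)))).
    assert (B' := B ltac:(
      intros j Hj; eapply Rle_trans; [apply HL; apply grid_unit; lia|];
      rewrite S_INR; replace ((INR j + 1) / INR (S M) - INR j / INR (S M))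
        with (/ INR (S M)) by (field; lra);
      rewrite Rabs_pos_eq; [right; reflexivity|left; apply Rinv_0_lt_compat; lra])).
    clear B E. set (A := sum_n (fun j => _ * (c j - _)) M) in *. clearbody A.
    assert (INR M * (L / INR (S M)) <= L).
    { apply (Rmult_le_reg_r (INR (S M))); [lra|]. field_simplify; [|lra].
      rewrite S_INR. nra. }
    replace A with ((A + f (INR M / INR (S M)) * c (S M)) - f (INR M / INR (S M)) * c (S M)) by ring.
    unfold Rminus. eapply Rle_trans; [apply Rabs_triang|].
    rewrite Rabs_Ropp, Rabs_mult.
    pose proof (HF _ (grid_unit M M ltac:(lia))).
    pose proof (Hc (S M)). pose proof (Rabs_pos (c (S M))).
    pose proof (Rabs_pos (f (INR M / INR (S M)))). nra. }
  rewrite Rabs_mult, (Rabs_pos_eq (2 * sin _)) in HB.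
  2:{ assert (0 <= INR n / (4 * INR (S M))) by (apply Rdiv_le_0_compat; lra). lra. }
  unfold dst. fold S0. rewrite Rabs_mult, Rabs_pos_eq by (left; apply Rinv_0_lt_compat; lra).
  apply (Rmult_le_reg_l (INR n)); [lra|].
  replace (INR n * (2 * (2 * F + L) / INR n)) with (2 * (2 * F + L)) by (field; lra).
  eapply Rle_trans; [|apply Rmult_le_compat_l; [lra|apply HB]].
  rewrite <- !Rmult_assoc. apply Rmult_le_compat_r; [apply Rabs_pos|].
  replace (INR n * / INR (S M)) with (4 * (INR n / (4 * INR (S M)))) by (field; lra). lra.
Qed.

(** * Parseval for the sine series of a Lipschitz function *)


(** Retraction of the line onto the unit interval. Composition with it extends a function given on
    the interval to the whole line without changing its integral from [0] to [1]. *)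
Definition clamp (x : R) : R := Rmax 0 (Rmin 1 x).

Lemma clamp_unit (x : R) : 0 <= clamp x <= 1.
Proof. unfold clamp, Rmax, Rmin. repeat destruct Rle_dec; lra. Qed.

Lemma clamp_id (x : R) : 0 <= x <= 1 -> clamp x = x.
Proof. intros. unfold clamp, Rmax, Rmin. repeat destruct Rle_dec; lra. Qed.

Lemma clamp_lipschitz (x y : R) : Rabs (clamp x - clamp y) <= Rabs (x - y).
Proof.
  unfold clamp, Rmax, Rmin, Rabs.
  repeat (destruct Rle_dec || destruct Rcase_abs); lra.
Qed.

Lemma lipschitz_unit_nonneg (f : R -> R) (L : R) : lipschitz_unit f L -> 0 <= L.
Proof.
  intros HL. pose proof (HL 1 0 ltac:(lra) ltac:(lra)) as H1.
  rewrite Rminus_0_r, Rabs_R1 in H1. pose proof (Rabs_pos (f 1 - f 0)). lra.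
Qed.

Lemma lipschitz_continuous (f : R -> R) (L : R) (x : R) :
  (forall x y, Rabs (f x - f y) <= L * Rabs (x - y)) -> continuous f x.
Proof.
  intros HL. apply continuity_pt_filterlim. intros eps Heps.
  assert (HL' : 0 < Rabs L + 1) by (pose proof (Rabs_pos L); lra).
  exists (eps / (Rabs L + 1)). split.
  - apply Rdiv_lt_0_compat; lra.
  - intros y [_ Hy]. simpl in *. unfold R_dist in *.
    eapply Rle_lt_trans; [apply HL|].
    apply Rle_lt_trans with ((Rabs L + 1) * Rabs (y - x)).
    + apply Rmult_le_compat_r; [apply Rabs_pos|]. pose proof (Rle_abs L). lra.
    + apply (Rmult_lt_compat_l (Rabs L + 1)) in Hy; [|lra].
      replace ((Rabs L + 1) * (eps / (Rabs L + 1))) with eps in Hy by (field; lra). lra.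
Qed.

Lemma ex_RInt_lipschitz_unit (f : R -> R) (L : R) :
  lipschitz_unit f L -> ex_RInt f 0 1.
Proof.
  intros HL. apply ex_RInt_ext with (fun x => f (clamp x)).
  - intros x. rewrite Rmin_left, Rmax_right by lra. intros Hx.
    rewrite clamp_id by lra. reflexivity.
  - apply (ex_RInt_continuous (V := R_CompleteNormedModule)). intros x _.
    apply lipschitz_continuous with L. intros y z.
    eapply Rle_trans; [apply HL; apply clamp_unit|].
    apply Rmult_le_compat_l; [eapply lipschitz_unit_nonneg; eauto|apply clamp_lipschitz].
Qed.

Lemma riemann_sum_error (g : R -> R) (L : R) (M : nat) :
  lipschitz_unit g L ->
  Rabs (/ INR (S M) * sum_n (fun j => g (INR j / INR (S M))) M - RInt g 0 1) <= L / INR (S M).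
Proof.
  intros HL.
  assert (HM : 0 < INR (S M)) by (apply lt_0_INR; lia).
  pose proof (ex_RInt_lipschitz_unit g L HL) as Hex.
  pose proof (lipschitz_unit_nonneg g L HL) as HL0.
  set (m := INR (S M)) in *.
  assert (Hsub : forall a b, 0 <= a <= b -> b <= 1 -> ex_RInt g a b).
  { intros a b Ha Hb. apply (ex_RInt_Chasles_2 (V := R_CompleteNormedModule)) with 0; [lra|].
    apply (ex_RInt_Chasles_1 (V := R_CompleteNormedModule)) with 1; [lra|exact Hex]. }
  assert (Hcell : forall j, (j <= M)%nat ->
    Rabs (/ m * g (INR j / m) - RInt g (INR j / m) (INR (S j) / m)) <= L / m * / m).
  { intros j Hj.
    pose proof (grid_unit M j ltac:(lia)) as G1. pose proof (grid_unit M (S j) ltac:(lia)) as G2.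
    fold m in G1, G2.
    assert (Hlen : INR (S j) / m - INR j / m = / m) by (rewrite S_INR; field; lra).
    assert (Hm : 0 < / m) by (apply Rinv_0_lt_compat; lra).
    assert (He : ex_RInt g (INR j / m) (INR (S j) / m)) by (apply Hsub; lra).
    rewrite Rabs_minus_sym.
    replace (/ m * g (INR j / m)) with (RInt (fun _ => g (INR j / m)) (INR j / m) (INR (S j) / m)).
    2:{ rewrite RInt_const. rewrite Hlen. reflexivity. }
    change (RInt g (INR j / m) (INR (S j) / m)
      - RInt (fun _ : R => g (INR j / m)) (INR j / m) (INR (S j) / m))
    with (minus (RInt g (INR j / m) (INR (S j) / m))
      (RInt (fun _ : R => g (INR j / m)) (INR j / m) (INR (S j) / m))).
    rewrite <- (RInt_minus (V := R_CompleteNormedModule)); [|exact He|apply ex_RInt_const].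
    rewrite <- Hlen, (Rmult_comm (L / m)).
    apply abs_RInt_le_const.
    - lra.
    - apply (ex_RInt_minus (V := R_NormedModule)); [exact He|apply ex_RInt_const].
    - intros t Ht. eapply Rle_trans; [apply HL; lra|].
      apply Rmult_le_compat_l; [lra|]. rewrite Rabs_pos_eq; lra. }
  assert (Hind : forall J, (J <= M)%nat ->
    Rabs (/ m * sum_n (fun j => g (INR j / m)) J - RInt g 0 (INR (S J) / m))
      <= INR (S J) * (L / m * / m)).
  { intros J. induction J as [|J IH]; intros HJ.
    - rewrite sum_n_O. pose proof (Hcell 0%nat ltac:(lia)) as H.
      change (INR 0) with 0 in *. replace (0 / m) with 0 in * by (unfold Rdiv; ring).
      rewrite Rmult_1_l. exact H.
    - rewrite sum_n_S, (S_INR (S J)).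
      pose proof (grid_unit M (S J) ltac:(lia)) as G1.
      pose proof (grid_unit M (S (S J)) ltac:(lia)) as G2. fold m in G1, G2.
      assert (Hlen : INR (S (S J)) / m - INR (S J) / m = / m)
        by (rewrite (S_INR (S J)); field; lra).
      assert (Hm : 0 < / m) by (apply Rinv_0_lt_compat; lra).
      rewrite <- (RInt_Chasles g 0 (INR (S J) / m)); [|apply Hsub; lra|rewrite <- S_INR; apply Hsub; lra].
      pose proof (IH ltac:(lia)) as H1. pose proof (Hcell (S J) HJ) as H2.
      rewrite (S_INR (S J)) in H2.
      change (@plus R_CompleteNormedModule) with Rplus.
      match goal with |- Rabs (?i * (?s + ?t) - (?p + ?q)) <= _ =>
        replace (i * (s + t) - (p + q)) with ((i * s - p) + (i * t - q)) by ring end.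
      eapply Rle_trans; [apply Rabs_triang|]. lra. }
  pose proof (Hind M ltac:(lia)) as H. fold m in H.
  replace (m / m) with 1 in H by (field; lra).
  replace (m * (L / m * / m)) with (L / m) in H by (field; lra). exact H.
Qed.

Definition sine_coef (f : R -> R) (n : nat) : R :=
  RInt (fun x => f x * sin (INR n * PI * x)) 0 1.

Lemma lipschitz_unit_mult (f g : R -> R) (F L F' L' : R) :
  (forall x, 0 <= x <= 1 -> Rabs (f x) <= F) -> lipschitz_unit f L ->
  (forall x, 0 <= x <= 1 -> Rabs (g x) <= F') -> lipschitz_unit g L' ->
  lipschitz_unit (fun x => f x * g x) (L * F' + F * L').
Proof.
  intros HF HL HF' HL' x y Hx Hy.
  replace (f x * g x - f y * g y) with ((f x - f y) * g x + f y * (g x - g y)) by ring.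
  eapply Rle_trans; [apply Rabs_triang|]. rewrite !Rabs_mult.
  pose proof (HL x y Hx Hy). pose proof (HF' x Hx). pose proof (HF y Hy).
  pose proof (HL' x y Hx Hy).
  pose proof (Rabs_pos (f x - f y)). pose proof (Rabs_pos (g x)).
  pose proof (Rabs_pos (f y)). pose proof (Rabs_pos (g x - g y)).
  pose proof (Rabs_pos (x - y)).
  assert (Rabs (f x - f y) * Rabs (g x) <= (L * Rabs (x - y)) * F')
    by (apply Rmult_le_compat; lra).
  assert (Rabs (f y) * Rabs (g x - g y) <= F * (L' * Rabs (x - y)))
    by (apply Rmult_le_compat; lra).
  lra.
Qed.

Lemma sin_lipschitz (w x y : R) : Rabs (sin (w * x) - sin (w * y)) <= Rabs w * Rabs (x - y).
Proof.
  destruct (MVT_gen sin (w * y) (w * x) cos) as [c [_ E]].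
  - intros z _. apply is_derive_Reals, derivable_pt_lim_sin.
  - intros z _. apply continuity_sin.
  - rewrite E, Rabs_mult. replace (w * x - w * y) with (w * (x - y)) by ring.
    rewrite Rabs_mult.
    assert (Rabs (cos c) <= 1) by (apply Rabs_le, COS_bound).
    pose proof (Rabs_pos w). pose proof (Rabs_pos (x - y)).
    pose proof (Rmult_le_pos _ _ H0 H1). nra.
Qed.

Lemma is_lim_seq_error (u : nat -> R) (l C : R) :
  (forall M, Rabs (u M - l) <= C / INR (S M)) -> is_lim_seq u l.
Proof.
  intros H. assert (H0 : is_lim_seq (fun M => C * / INR (S M)) 0).
  { replace (Finite 0) with (Rbar_mult C 0) by (simpl; f_equal; ring).
    apply is_lim_seq_scal_l. apply (is_lim_seq_incr_1 (fun n => / INR n)).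
    exact (is_lim_seq_inv _ _ is_lim_seq_INR ltac:(discriminate)). }
  apply is_lim_seq_le_le with (fun M => l - C * / INR (S M)) (fun M => l + C * / INR (S M)).
  - intros M. specialize (H M). apply Rabs_le_between in H. unfold Rdiv in H. lra.
  - evar_last. apply is_lim_seq_minus'; [apply is_lim_seq_const|exact H0].
    f_equal; ring.
  - evar_last. apply is_lim_seq_plus'; [apply is_lim_seq_const|exact H0].
    f_equal; ring.
Qed.

Lemma sum_n_nonneg_mono (a : nat -> R) (N M : nat) :
  (forall n, 0 <= a n) -> (N <= M)%nat -> sum_n a N <= sum_n a M.
Proof.
  intros Ha. induction 1 as [|M _ IH]; [lra|].
  rewrite sum_n_S. specialize (Ha (S M)). lra.
Qed.

(** Telescoping, from [1 / (n + 1)^2 <= 1 / n - 1 / (n + 1)]. The decay is assumed on a finite range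
    because [dst_bound] holds only up to the grid size. *)
Lemma sum_n_sqr_tail (a : nat -> R) (C : R) (N k : nat) :
  (1 <= N)%nat ->
  (forall n, (N < n <= N + k)%nat -> Rabs (a n) <= C / INR n) ->
  sum_n (fun n => a n ^ 2) (N + k)
  <= sum_n (fun n => a n ^ 2) N + C ^ 2 * (/ INR N - / INR (N + k)).
Proof.
  intros HN. induction k as [|k IH]; intros Ha.
  - rewrite Nat.add_0_r. lra.
  - rewrite Nat.add_succ_r, sum_n_S. specialize (IH ltac:(intros; apply Ha; lia)).
    pose proof (Ha (S (N + k)) ltac:(lia)) as H.
    assert (H0 : 0 < INR (N + k)) by (apply lt_0_INR; lia).
    assert (H1 : a (S (N + k)) ^ 2 <= (C / INR (S (N + k))) ^ 2).
    { rewrite <- (pow2_abs (a _)). apply pow_incr. split; [apply Rabs_pos|exact H]. }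
    assert (H2 : (C / INR (S (N + k))) ^ 2 <= C ^ 2 * (/ INR (N + k) - / INR (S (N + k)))).
    { unfold Rdiv. rewrite Rpow_mult_distr. apply Rmult_le_compat_l; [apply pow2_ge_0|].
      rewrite S_INR. apply (Rmult_le_reg_r (INR (N + k) * (INR (N + k) + 1) ^ 2)); [nra|].
      field_simplify; lra. }
    lra.
Qed.

Section Parseval.

Variables (f : R -> R) (F L : R).
Hypothesis HF : forall x, 0 <= x <= 1 -> Rabs (f x) <= F.
Hypothesis HL : lipschitz_unit f L.

Lemma dst_lim (n : nat) : is_lim_seq (fun M => dst f M n) (sine_coef f n).
Proof.
  apply is_lim_seq_error with (L * 1 + F * Rabs (INR n * PI)). intros M.
  unfold dst, sine_coef. apply (riemann_sum_error (fun x => f x * sin (INR n * PI * x))).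
  apply lipschitz_unit_mult; auto.
  - intros x _. apply Rabs_le, SIN_bound.
  - intros x y _ _. apply sin_lipschitz.
Qed.

Lemma sum_dst_lim (N : nat) :
  is_lim_seq (fun M => sum_n (fun n => dst f M n ^ 2) N) (sum_n (fun n => sine_coef f n ^ 2) N).
Proof.
  assert (H : forall n, is_lim_seq (fun M => dst f M n ^ 2) (sine_coef f n ^ 2)).
  { intros n. simpl. apply (is_lim_seq_mult' _ _ _ (sine_coef f n * 1)); [apply dst_lim|].
    apply is_lim_seq_mult'; [apply dst_lim|apply is_lim_seq_const]. }
  induction N as [|N IH].
  - rewrite sum_n_O. apply is_lim_seq_ext with (2 := H 0%nat). intros M. now rewrite sum_n_O.
  - rewrite sum_n_S. apply is_lim_seq_ext with
      (fun M => sum_n (fun n => dst f M n ^ 2) N + dst f M (S N) ^ 2).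
    + intros M. now rewrite sum_n_S.
    + now apply is_lim_seq_plus'.
Qed.

(** The number of terms grows with the grid, so termwise limits do not apply; [discrete_parseval]
    first converts the sum into a Riemann sum of [f ^ 2], up to a boundary term of order
    [1 / S M]. *)
Lemma discrete_energy_lim :
  is_lim_seq (fun M => 2 * sum_n (fun n => dst f M n ^ 2) M) (RInt (fun x => f x ^ 2) 0 1).
Proof.
  apply is_lim_seq_error with (L * F + F * L + f 0 ^ 2). intros M.
  assert (HM : 0 < INR (S M)) by (apply lt_0_INR; lia).
  rewrite discrete_parseval.
  assert (H : lipschitz_unit (fun x => f x ^ 2) (L * F + F * L)).
  { intros x y Hx Hy. simpl. rewrite !Rmult_1_r.
    exact (lipschitz_unit_mult f f F L F L HF HL HF HL x y Hx Hy). }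
  pose proof (riemann_sum_error _ _ M H) as E. cbv beta in E.
  match goal with |- Rabs (?a - ?b - ?c) <= _ =>
    replace (a - b - c) with ((a - c) + - b) by ring end.
  eapply Rle_trans; [apply Rabs_triang|]. rewrite Rabs_Ropp.
  rewrite (Rabs_pos_eq (f 0 ^ 2 / INR (S M)));
    [|apply Rdiv_le_0_compat; [apply pow2_ge_0|lra]].
  replace ((L * F + F * L + f 0 ^ 2) / INR (S M))
    with ((L * F + F * L) / INR (S M) + f 0 ^ 2 / INR (S M)) by (field; lra). lra.
Qed.

(** With [N] frozen, termwise limits are legitimate, and for [M >= N] the truncated discrete sum is
    below the full one. *)
Lemma sine_bessel (N : nat) :
  2 * sum_n (fun n => sine_coef f n ^ 2) N <= RInt (fun x => f x ^ 2) 0 1.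
Proof.
  apply (is_lim_seq_le_loc (fun M => 2 * sum_n (fun n => dst f M n ^ 2) N)
    (fun M => 2 * sum_n (fun n => dst f M n ^ 2) M) (Finite _) (Finite _)).
  - exists N. intros M HM. apply Rmult_le_compat_l; [lra|].
    apply sum_n_nonneg_mono; [intros; apply pow2_ge_0|exact HM].
  - apply (is_lim_seq_scal_l _ 2 (Finite _)), sum_dst_lim.
  - apply discrete_energy_lim.
Qed.

(** The danger is energy escaping to ever higher frequencies as the grid is refined. [dst_bound],
    uniform in the grid, limits the energy beyond [N] to [2 * C ^ 2 / N], and [N] is sent to
    infinity last. *)
Lemma sine_parseval_le (B : R) :
  (forall N, 2 * sum_n (fun n => sine_coef f n ^ 2) N <= B) ->
  RInt (fun x => f x ^ 2) 0 1 <= B.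
Proof.
  intros HB. set (C := 2 * (2 * F + L)).
  assert (H : forall N, (1 <= N)%nat -> RInt (fun x => f x ^ 2) 0 1 <= B + 2 * C ^ 2 * / INR N).
  { intros N HN. eapply Rle_trans; [|apply Rplus_le_compat_r, (HB N)].
    apply (is_lim_seq_le_loc (fun M => 2 * sum_n (fun n => dst f M n ^ 2) M)
      (fun M => 2 * sum_n (fun n => dst f M n ^ 2) N + 2 * C ^ 2 * / INR N) (Finite _) (Finite _)).
    - exists N. intros M HM.
      pose proof (sum_n_sqr_tail (dst f M) C N (M - N) HN
        ltac:(intros n Hn; apply dst_bound; auto; lia)) as H.
      replace (N + (M - N))%nat with M in H by lia.
      assert (0 < / INR M) by (apply Rinv_0_lt_compat, lt_0_INR; lia).
      pose proof (pow2_ge_0 C). nra.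
    - apply discrete_energy_lim.
    - apply is_lim_seq_plus'; [|apply is_lim_seq_const].
      apply (is_lim_seq_scal_l _ 2 (Finite _)), sum_dst_lim. }
  apply (is_lim_seq_le (fun _ => RInt (fun x => f x ^ 2) 0 1)
    (fun N => B + 2 * C ^ 2 * / INR (S N)) (Finite _) (Finite _)).
  - intros N. apply H. lia.
  - apply is_lim_seq_const.
  - apply is_lim_seq_error with (2 * C ^ 2). intros N.
    replace (B + 2 * C ^ 2 * / INR (S N) - B) with (2 * C ^ 2 / INR (S N)) by (unfold Rdiv; ring).
    right. apply Rabs_pos_eq, Rdiv_le_0_compat; [pose proof (pow2_ge_0 C); lra|].
    apply lt_0_INR; lia.
Qed.

End Parseval.

(** * Calculus on the unit interval *)


(** Continuity relative to the interval, one-sided at its ends, rephrased as ordinary continuity of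
    the clamped extension. *)
Definition continuous_unit (p : R -> R) : Prop := forall x, continuous (fun y => p (clamp y)) x.

Lemma continuous_clamp (x : R) : continuous clamp x.
Proof.
  apply lipschitz_continuous with 1. intros y z. rewrite Rmult_1_l. apply clamp_lipschitz.
Qed.

Lemma filterlim_clamp (x : R) :
  filterlim clamp (locally x) (within unit_interval (locally (clamp x))).
Proof.
  intros P HP. unfold within in HP.
  generalize (continuous_clamp x _ HP). unfold filtermap. apply filter_imp.
  intros y Hy. apply Hy, clamp_unit.
Qed.

Lemma continuous_on_unit (p : R -> R) : continuous_on unit_interval p -> continuous_unit p.
Proof.
  intros Hp x. unfold continuous.
  eapply filterlim_comp; [apply filterlim_clamp|]. apply (Hp (clamp x)), clamp_unit.
Qed.

Lemma continuous_unit_global (p : R -> R) : (forall x, continuous p x) -> continuous_unit p.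
Proof. intros Hp x. apply continuous_comp; [apply continuous_clamp|apply Hp]. Qed.

Lemma continuous_unit_plus (p q : R -> R) :
  continuous_unit p -> continuous_unit q -> continuous_unit (fun x => p x + q x).
Proof. intros Hp Hq x. exact (continuous_plus _ _ x (Hp x) (Hq x)). Qed.

Lemma continuous_unit_mult (p q : R -> R) :
  continuous_unit p -> continuous_unit q -> continuous_unit (fun x => p x * q x).
Proof. intros Hp Hq x. exact (continuous_mult _ _ x (Hp x) (Hq x)). Qed.

Lemma continuous_unit_scal (c : R) (p : R -> R) :
  continuous_unit p -> continuous_unit (fun x => c * p x).
Proof. intros Hp. apply continuous_unit_mult; [intros x; apply continuous_const|exact Hp]. Qed.

Lemma continuous_sin_scal (w x : R) : continuous (fun y => sin (w * y)) x.
Proof. apply (ex_derive_continuous (V := R_NormedModule)). auto_derive. trivial. Qed.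

Lemma continuous_cos_scal (w x : R) : continuous (fun y => cos (w * y)) x.
Proof. apply (ex_derive_continuous (V := R_NormedModule)). auto_derive. trivial. Qed.

Lemma continuous_unit_sin (w : R) : continuous_unit (fun x => sin (w * x)).
Proof. apply continuous_unit_global, continuous_sin_scal. Qed.

Lemma continuous_unit_cos (w : R) : continuous_unit (fun x => cos (w * x)).
Proof. apply continuous_unit_global, continuous_cos_scal. Qed.

Lemma ex_RInt_unit (p : R -> R) : continuous_unit p -> ex_RInt p 0 1.
Proof.
  intros Hp. apply ex_RInt_ext with (fun x => p (clamp x)).
  - intros x. rewrite Rmin_left, Rmax_right by lra. intros Hx.
    rewrite clamp_id by lra. reflexivity.
  - apply (ex_RInt_continuous (V := R_CompleteNormedModule)). intros x _. apply Hp.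
Qed.

Lemma continuous_unit_bounded (p : R -> R) :
  continuous_unit p -> exists C, forall x, 0 <= x <= 1 -> Rabs (p x) <= C.
Proof.
  intros Hp.
  destruct (continuity_ab_maj (fun x => Rabs (p (clamp x))) 0 1 ltac:(lra)) as [m [Hm _]].
  - intros c _. apply continuity_pt_filterlim.
    apply (continuous_comp (fun x => p (clamp x)) Rabs); [apply Hp|apply continuous_Rabs].
  - exists (Rabs (p (clamp m))). intros x Hx.
    pose proof (Hm x Hx) as H. rewrite (clamp_id x Hx) in H. exact H.
Qed.

Lemma locally_interior (a b x : R) : a < x < b -> locally x (fun y => a < y < b).
Proof.
  intros Hx. apply (locally_interval _ x a b); simpl; try lra. intros; lra.
Qed.

Lemma mvt_unit (P p : R -> R) (x y : R) :
  (forall x, 0 < x < 1 -> is_derive P x (p x)) -> continuous_unit P ->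
  0 <= x <= y -> y <= 1 -> exists c, 0 <= c <= 1 /\ P y - P x = p c * (y - x).
Proof.
  intros HP HcP Hx Hy.
  destruct (MVT_gen (fun z => P (clamp z)) x y p) as [c [Hc E]];
    try rewrite Rmin_left, Rmax_right in * by lra.
  - intros z Hz. apply is_derive_ext_loc with P; [|apply HP; lra].
    apply filter_imp with (2 := locally_interior 0 1 z ltac:(lra)).
    intros t Ht. now rewrite clamp_id by lra.
  - intros z _. apply continuity_pt_filterlim, HcP.
  - exists c. rewrite !clamp_id in E by lra. split; [lra|exact E].
Qed.

(** The derivative of [P] is known in the open interval only, so [P] is compared with the primitive
    [Q] of the clamped integrand: [P - Q] has zero derivative inside and is continuous up to the
    ends. *)
Lemma ftc_unit (P p : R -> R) :
  (forall x, 0 < x < 1 -> is_derive P x (p x)) ->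
  continuous_unit P -> continuous_unit p -> is_RInt p 0 1 (P 1 - P 0).
Proof.
  intros HP HcP Hcp.
  set (q := fun x => p (clamp x)).
  assert (Hex : forall a b, ex_RInt q a b).
  { intros a b. apply (ex_RInt_continuous (V := R_CompleteNormedModule)). intros x _. apply Hcp. }
  set (Q := fun x => RInt q 0 x).
  assert (HQ : forall x, is_derive Q x (q x)).
  { intros x. apply (is_derive_RInt (V := R_NormedModule)) with 0; [|apply Hcp].
    apply filter_forall. intros b. apply (RInt_correct (V := R_CompleteNormedModule)), Hex. }
  destruct (mvt_unit (fun x => P x - Q x) (fun _ => 0) 0 1) as [c [_ E]]; try lra.
  - intros x Hx. replace 0 with (minus (p x) (q x)).
    + apply (is_derive_minus (V := R_NormedModule)); [now apply HP|apply HQ].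
    + unfold q. rewrite clamp_id by lra. apply Rminus_diag.
  - intros x. apply (continuous_minus (V := R_NormedModule)); [apply HcP|].
    apply continuous_comp; [apply continuous_clamp|].
    apply (ex_derive_continuous (V := R_NormedModule)). eexists; apply HQ.
  - assert (Q0 : Q 0 = 0) by apply (RInt_point (V := R_CompleteNormedModule)).
    replace (P 1 - P 0) with (Q 1) by lra.
    apply is_RInt_ext with q.
    + intros x. rewrite Rmin_left, Rmax_right by lra. intros Hx. unfold q.
      now rewrite clamp_id by lra.
    + apply (RInt_correct (V := R_CompleteNormedModule)), Hex.
Qed.

Lemma lipschitz_of_derive (f f1 : R -> R) (C : R) :
  (forall x, 0 < x < 1 -> is_derive f x (f1 x)) -> continuous_unit f ->
  (forall x, 0 <= x <= 1 -> Rabs (f1 x) <= C) -> lipschitz_unit f C.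
Proof.
  intros Hf Hc HC.
  assert (H : forall x y, 0 <= x <= y -> y <= 1 -> Rabs (f y - f x) <= C * Rabs (y - x)).
  { intros x y Hx Hy. destruct (mvt_unit f f1 x y Hf Hc Hx Hy) as [c [Hc' E]].
    rewrite E, Rabs_mult. apply Rmult_le_compat_r; [apply Rabs_pos|now apply HC]. }
  intros x y Hx Hy. destruct (Rle_dec x y).
  - rewrite (Rabs_minus_sym (f x)), (Rabs_minus_sym x). apply H; lra.
  - apply H; lra.
Qed.

Lemma RInt_Rplus (p q : R -> R) :
  ex_RInt p 0 1 -> ex_RInt q 0 1 ->
  RInt (fun x => p x + q x) 0 1 = RInt p 0 1 + RInt q 0 1.
Proof. exact (RInt_plus (V := R_CompleteNormedModule) p q 0 1). Qed.

Lemma RInt_Rscal (c : R) (p : R -> R) :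
  ex_RInt p 0 1 -> RInt (fun x => c * p x) 0 1 = c * RInt p 0 1.
Proof. intros H. exact (RInt_scal (V := R_CompleteNormedModule) p 0 1 c H). Qed.

Lemma ex_RInt_sine (f : R -> R) (w : R) :
  continuous_unit f -> ex_RInt (fun x => f x * sin (w * x)) 0 1.
Proof. intros Hf. apply ex_RInt_unit, continuous_unit_mult; [exact Hf|apply continuous_unit_sin]. Qed.

Lemma sine_coef_plus (f g : R -> R) (n : nat) :
  continuous_unit f -> continuous_unit g ->
  sine_coef (fun x => f x + g x) n = sine_coef f n + sine_coef g n.
Proof.
  intros Hf Hg. unfold sine_coef. rewrite <- RInt_Rplus by now apply ex_RInt_sine.
  apply RInt_ext. intros x _. real_eq. ring.
Qed.

Lemma sine_coef_scal (c : R) (f : R -> R) (n : nat) :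
  continuous_unit f -> sine_coef (fun x => c * f x) n = c * sine_coef f n.
Proof.
  intros Hf. unfold sine_coef. rewrite <- RInt_Rscal by now apply ex_RInt_sine.
  apply RInt_ext. intros x _. real_eq. ring.
Qed.

Lemma sine_coef_ext (f g : R -> R) (n : nat) :
  (forall x, 0 < x < 1 -> f x = g x) -> sine_coef f n = sine_coef g n.
Proof.
  intros E. apply RInt_ext. intros x. rewrite Rmin_left, Rmax_right by lra. intros Hx.
  now rewrite E.
Qed.

(** Two integrations by parts at once, with [P] collecting the boundary terms. The sine kills [f1]
    at both ends and [f 1 = 0] kills one trace of [f]; the surviving [w * f 0] is how the boundary
    input enters the modal equation. *)
Lemma sine_coef_derive2 (f f1 f2 : R -> R) (n : nat) :
  (forall x, 0 < x < 1 -> is_derive f x (f1 x)) ->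
  (forall x, 0 < x < 1 -> is_derive f1 x (f2 x)) ->
  continuous_unit f -> continuous_unit f1 -> continuous_unit f2 ->
  f 1 = 0 ->
  sine_coef f2 n = INR n * PI * f 0 - (INR n * PI) ^ 2 * sine_coef f n.
Proof.
  intros D1 D2 C0 C1 C2 H1. set (w := INR n * PI).
  set (P := fun x => f1 x * sin (w * x) + (- w) * (f x * cos (w * x))).
  assert (H := ftc_unit P (fun x => f2 x * sin (w * x) + w ^ 2 * (f x * sin (w * x)))).
  apply (is_RInt_unique (V := R_CompleteNormedModule)) in H.
  - assert (X : ex_RInt (fun x => f x * sin (w * x)) 0 1) by now apply ex_RInt_sine.
    rewrite (RInt_Rplus (fun x => f2 x * sin (w * x)) (fun x => w ^ 2 * (f x * sin (w * x)))),
      (RInt_Rscal (w ^ 2) _ X) in H.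
    2:{ now apply ex_RInt_sine. }
    2:{ apply ex_RInt_unit, continuous_unit_scal, continuous_unit_mult;
          [assumption|apply continuous_unit_sin]. }
    change (sine_coef f2 n + w ^ 2 * sine_coef f n = P 1 - P 0) in H.
    replace (P 1 - P 0) with (w * f 0) in H.
    + lra.
    + unfold P. rewrite H1, Rmult_1_r, Rmult_0_r, sin_0, cos_0.
      unfold w. rewrite sin_INR_PI. ring.
  - intros x Hx. unfold P. specialize (D1 x Hx). specialize (D2 x Hx).
    auto_derive.
    + repeat split; eexists; eassumption.
    + replace (Derive (fun y : R => f y) x) with (f1 x) by (symmetry; now apply is_derive_unique).
      replace (Derive (fun y : R => f1 y) x) with (f2 x) by (symmetry; now apply is_derive_unique).
      ring.
  - apply continuous_unit_plus; [|apply continuous_unit_scal];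
      apply continuous_unit_mult; auto using continuous_unit_sin, continuous_unit_cos.
  - apply continuous_unit_plus; [|apply continuous_unit_scal];
      apply continuous_unit_mult; auto using continuous_unit_sin, continuous_unit_cos.
Qed.

(** One integration by parts gains a factor [/ w]; the two boundary terms account for [2 * F]. It
    provides the [O(1 / n)] size of the displacement modes at the starting time [1]. *)
Lemma sine_coef_decay (f f1 : R -> R) :
  (forall x, 0 < x < 1 -> is_derive f x (f1 x)) ->
  continuous_unit f -> continuous_unit f1 ->
  exists C, 0 <= C /\ forall n, (1 <= n)%nat -> Rabs (sine_coef f n) <= C / INR n.
Proof.
  intros D C0 C1.
  destruct (continuous_unit_bounded f C0) as [F HF].
  destruct (continuous_unit_bounded f1 C1) as [F1 HF1].
  pose proof (Rabs_pos (f 0)). pose proof (HF 0 ltac:(lra)) as HF0.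
  pose proof (Rabs_pos (f1 0)). pose proof (HF1 0 ltac:(lra)).
  exists (2 * F + F1). split; [lra|]. intros n Hn.
  assert (Hn0 : 0 < INR n) by (apply lt_0_INR; lia).
  pose proof PI2_3_2.
  set (w := INR n * PI). assert (Hw : INR n <= w) by (unfold w; nra).
  set (P := fun x => - / w * (f x * cos (w * x))).
  assert (E := ftc_unit P (fun x => f x * sin (w * x) + - / w * (f1 x * cos (w * x)))).
  apply (is_RInt_unique (V := R_CompleteNormedModule)) in E.
  - assert (X1 : ex_RInt (fun x => f1 x * cos (w * x)) 0 1).
    { apply ex_RInt_unit, continuous_unit_mult; [assumption|apply continuous_unit_cos]. }
    rewrite (RInt_Rplus (fun x => f x * sin (w * x)) (fun x => - / w * (f1 x * cos (w * x)))),
      (RInt_Rscal (- / w) _ X1) in E.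
    2:{ now apply ex_RInt_sine. }
    2:{ apply ex_RInt_unit, continuous_unit_scal, continuous_unit_mult;
          [assumption|apply continuous_unit_cos]. }
    change (sine_coef f n + - / w * RInt (fun x => f1 x * cos (w * x)) 0 1 = P 1 - P 0) in E.
    set (I := RInt (fun x => f1 x * cos (w * x)) 0 1) in *.
    assert (HI : Rabs I <= F1).
    { replace F1 with ((1 - 0) * F1) by ring. apply abs_RInt_le_const; [lra|assumption|].
      intros x Hx. rewrite Rabs_mult. pose proof (HF1 x Hx).
      assert (Rabs (cos (w * x)) <= 1) by (apply Rabs_le, COS_bound).
      pose proof (Rabs_pos (f1 x)). pose proof (Rabs_pos (cos (w * x))). nra. }
    unfold P in E. rewrite Rmult_1_r, Rmult_0_r, cos_0 in E.
    assert (Hc : Rabs (cos w) <= 1) by (apply Rabs_le, COS_bound).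
    pose proof (HF 1 ltac:(lra)) as HF1'.
    replace (sine_coef f n) with (/ w * (I + f 0 - f 1 * cos w)) by lra.
    assert (Hb : Rabs (I + f 0 - f 1 * cos w) <= 2 * F + F1).
    { assert (Rabs (f 1 * cos w) <= F).
      { rewrite Rabs_mult. pose proof (Rabs_pos (f 1)). pose proof (Rabs_pos (cos w)). nra. }
      apply Rabs_le. apply Rabs_le_between in HI, HF0, H3. lra. }
    rewrite Rabs_mult, Rabs_pos_eq by (left; apply Rinv_0_lt_compat; lra).
    unfold Rdiv. rewrite Rmult_comm. apply Rmult_le_compat; try apply Rabs_pos; try lra.
    + left; apply Rinv_0_lt_compat; lra.
    + apply Rinv_le_contravar; lra.
  - intros x Hx. unfold P. specialize (D x Hx). auto_derive.
    + repeat split; eexists; eassumption.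
    + replace (Derive (fun y : R => f y) x) with (f1 x) by (symmetry; now apply is_derive_unique).
      field. lra.
  - apply continuous_unit_scal, continuous_unit_mult; auto using continuous_unit_cos.
  - apply continuous_unit_plus; [|apply continuous_unit_scal];
      apply continuous_unit_mult; auto using continuous_unit_sin, continuous_unit_cos.
Qed.

(* Bessel's inequality for [1 - x], whose sine coefficients are [1 / (n PI)]; the term
   [n = 0] vanishes because [/ 0 = 0]. *)
Lemma sum_inv_sq_le (N : nat) :
  2 * sum_n (fun n => (1 / (INR n * PI)) ^ 2) N <= 1 / 3.
Proof.
  set (f := fun x => 1 - x).
  assert (Df : forall x, is_derive f x (-1)).
  { intros x. unfold f. auto_derive; [trivial|ring]. }
  assert (Cf : continuous_unit f).
  { apply continuous_unit_global. intros x.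
    apply (ex_derive_continuous (V := R_NormedModule)). eexists; apply Df. }
  assert (Cc : forall c, continuous_unit (fun _ => c)) by (intros c x; apply continuous_const).
  assert (HF : forall x, 0 <= x <= 1 -> Rabs (f x) <= 1).
  { intros x Hx. unfold f. apply Rabs_le. lra. }
  assert (HL : lipschitz_unit f 1).
  { intros x y _ _. unfold f. rewrite Rabs_minus_sym.
    replace (1 - y - (1 - x)) with (x - y) by ring. lra. }
  assert (E : forall n, sine_coef f n = 1 / (INR n * PI)).
  { intros [|n].
    - unfold sine_coef. rewrite (RInt_ext _ (fun _ => 0)).
      + rewrite RInt_const. simpl INR. rewrite Rmult_0_l. unfold Rdiv. rewrite Rinv_0.
        unfold scal; simpl; unfold mult; simpl. ring.
      + intros x _. simpl INR. rewrite Rmult_0_l, Rmult_0_l, sin_0. real_eq. ring.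
    - pose proof (sine_coef_derive2 f (fun _ => -1) (fun _ => 0) (S n)
        (fun x _ => Df x)) as H.
      assert (Hn : 0 < INR (S n)) by (apply lt_0_INR; lia). pose proof PI_RGT_0 as Hpi.
      assert (H0 : sine_coef (fun _ => 0) (S n) = 0).
      { pose proof (sine_coef_scal 0 f (S n) Cf) as Z.
        rewrite Rmult_0_l in Z. etransitivity; [|exact Z]. apply sine_coef_ext. intros; ring. }
      assert (Hw : 0 < INR (S n) * PI) by nra.
      set (w := INR (S n) * PI) in *.
      rewrite H0 in H.
      assert (D0 : forall x, 0 < x < 1 -> is_derive (fun _ => -1) x 0)
        by (intros x _; exact (is_derive_const (V := R_NormedModule) (-1) x)).
      assert (f0 : f 0 = 1) by (unfold f; lra). assert (f1 : f 1 = 0) by (unfold f; lra).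
      specialize (H D0 Cf (Cc _) (Cc _) f1). rewrite f0 in H.
      apply (Rmult_eq_reg_l (w ^ 2)); [|nra].
      replace (w ^ 2 * (1 / w)) with w by (field; lra).
      lra. }
  rewrite (sum_n_Rext _ (fun n => sine_coef f n ^ 2)) by (intros; now rewrite E).
  eapply Rle_trans; [apply (sine_bessel f 1 1 HF HL)|].
  right. apply (is_RInt_unique (V := R_CompleteNormedModule)).
  replace (1 / 3) with (- (1 - 1) ^ 3 / 3 - - (1 - 0) ^ 3 / 3) by field.
  apply (ftc_unit (fun x => - (1 - x) ^ 3 / 3)).
  - intros x _. unfold f. auto_derive; [trivial|field].
  - apply continuous_unit_global. intros x.
    apply (ex_derive_continuous (V := R_NormedModule)). auto_derive. trivial.
  - apply continuous_unit_global. intros x.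
    apply (ex_derive_continuous (V := R_NormedModule)). unfold f. auto_derive. trivial.
Qed.

(** * Impulse responses and their L1 norms *)


(** The response of [y'' + a y' + w^2 y] to a unit impulse, with its decay included. Requiring the
    equations on the whole line avoids one-sided derivatives at [0]. *)
Definition fundamental_solution (a w : R) (K K1 : R -> R) : Prop :=
  K 0 = 0 /\ K1 0 = 1 /\
  (forall t, is_derive K t (K1 t)) /\
  (forall t, is_derive K1 t (- a * K1 t - w ^ 2 * K t)) /\
  is_lim K p_infty 0 /\ is_lim K1 p_infty 0.

(** The kernel against [d] itself: the term [sigma * d'] of the forcing is integrated by parts,
    which differentiates [K]. *)
Definition impulse_response (sigma w : R) (K K1 : R -> R) (t : R) : R :=
  w * (K t + sigma * K1 t).

Section L1.

Variables (sigma a w : R) (K K1 : R -> R).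
Hypothesis Hw : 0 < w.
Hypothesis HK : fundamental_solution a w K K1.

Let h := impulse_response sigma w K K1.

(* Since [(K1 + a K)' = - w^2 K], this is the primitive of [h] that vanishes at infinity. *)
Definition step_defect (t : R) : R := w * sigma * K t - (K1 t + a * K t) / w.

Lemma step_defect_derive (t : R) : is_derive step_defect t (h t).
Proof.
  destruct HK as (_ & _ & D0 & D1 & _). unfold step_defect, h, impulse_response.
  specialize (D0 t). specialize (D1 t). auto_derive.
  - repeat split; eexists; eassumption.
  - replace (Derive (fun y : R => K y) t) with (K1 t) by (symmetry; now apply is_derive_unique).
    replace (Derive (fun y : R => K1 y) t) with (- a * K1 t - w ^ 2 * K t)
      by (symmetry; now apply is_derive_unique).
    field. lra.
Qed.

(** Together with [step_defect_lim], this says that [h] integrates to [/ w] over the half line, the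
    limiting response to the constant input [1]. *)
Lemma step_defect_0 : step_defect 0 = - / w.
Proof. destruct HK as (E0 & E1 & _). unfold step_defect. rewrite E0, E1. field. lra. Qed.

Lemma step_defect_lim : is_lim step_defect p_infty 0.
Proof.
  destruct HK as (_ & _ & _ & _ & L0 & L1). unfold step_defect.
  apply is_lim_ext with (fun t => (w * sigma - a / w) * K t - / w * K1 t).
  - intros t. field. lra.
  - replace (Finite 0) with (Finite ((w * sigma - a / w) * 0 - / w * 0)) by (f_equal; ring).
    apply is_lim_minus'.
    + apply (is_lim_scal_l K _ p_infty 0 L0).
    + apply (is_lim_scal_l K1 _ p_infty 0 L1).
Qed.

Lemma impulse_continuous (t : R) : continuous h t.
Proof.
  destruct HK as (_ & _ & D0 & D1 & _).
  apply (ex_derive_continuous (V := R_NormedModule)).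
  unfold h, impulse_response. specialize (D0 t). specialize (D1 t).
  auto_derive. repeat split; eexists; eassumption.
Qed.

Lemma ex_RInt_abs_impulse (x y : R) : ex_RInt (fun t => Rabs (h t)) x y.
Proof.
  apply (ex_RInt_continuous (V := R_CompleteNormedModule)). intros t _.
  apply (continuous_comp h Rabs); [apply impulse_continuous|apply continuous_Rabs].
Qed.

Lemma RInt_abs_impulse_mono (T T' : R) :
  0 <= T <= T' -> RInt (fun t => Rabs (h t)) 0 T <= RInt (fun t => Rabs (h t)) 0 T'.
Proof.
  intros HT. rewrite <- (RInt_Chasles _ 0 T T') by apply ex_RInt_abs_impulse.
  change (@plus R_CompleteNormedModule) with Rplus.
  assert (0 <= RInt (fun t => Rabs (h t)) T T'); [|lra].
  apply RInt_ge_0; [lra|apply ex_RInt_abs_impulse|]. intros; apply Rabs_pos.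
Qed.

Lemma RInt_impulse (x y : R) : is_RInt h x y (step_defect y - step_defect x).
Proof.
  apply (is_RInt_derive (V := R_CompleteNormedModule)).
  - intros; apply step_defect_derive.
  - intros; apply impulse_continuous.
Qed.

Lemma RInt_abs_impulse_pos (x y : R) :
  x <= y -> (forall t, x < t < y -> 0 <= h t) ->
  RInt (fun t => Rabs (h t)) x y = step_defect y - step_defect x.
Proof.
  intros Hxy Hh. apply (is_RInt_unique (V := R_CompleteNormedModule)).
  apply is_RInt_ext with h; [|apply RInt_impulse].
  intros t. rewrite Rmin_left, Rmax_right by lra. intros Ht.
  symmetry. now apply Rabs_pos_eq, Hh.
Qed.

Lemma RInt_abs_impulse_neg (x y : R) :
  x <= y -> (forall t, x < t < y -> h t <= 0) ->
  RInt (fun t => Rabs (h t)) x y = step_defect x - step_defect y.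
Proof.
  intros Hxy Hh. apply (is_RInt_unique (V := R_CompleteNormedModule)).
  apply is_RInt_ext with (fun t => opp (h t)).
  - intros t. rewrite Rmin_left, Rmax_right by lra. intros Ht.
    symmetry. now apply Rabs_left1, Hh.
  - replace (step_defect x - step_defect y) with (opp (step_defect y - step_defect x))
      by (unfold opp; simpl; ring).
    apply (is_RInt_opp (V := R_NormedModule)), RInt_impulse.
Qed.

(** The integral increases with its endpoint while the defect tends to [0], so an estimate with
    error at late times gives one without error at every time. *)
Lemma RInt_abs_impulse_limit (C T0 T : R) :
  (forall t, T0 <= t -> RInt (fun s => Rabs (h s)) 0 t <= C + Rabs (step_defect t)) ->
  0 <= T -> RInt (fun s => Rabs (h s)) 0 T <= C.
Proof.
  intros H HT. apply le_epsilon. intros eps Heps.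
  pose proof step_defect_lim as L. apply is_lim_spec in L.
  destruct (L (mkposreal eps Heps)) as [T1 HT1]. simpl in HT1.
  set (t := Rmax T (Rmax T0 (T1 + 1))).
  assert (T <= t) by apply Rmax_l.
  assert (T0 <= t) by (eapply Rle_trans; [|apply Rmax_r]; apply Rmax_l).
  assert (T1 + 1 <= t) by (eapply Rle_trans; [|apply Rmax_r]; apply Rmax_r).
  specialize (HT1 t ltac:(lra)). rewrite Rminus_0_r in HT1.
  specialize (H t ltac:(lra)).
  pose proof (RInt_abs_impulse_mono T t ltac:(lra)). lra.
Qed.

Lemma impulse_L1_pos (T : R) :
  (forall t, 0 <= t -> 0 <= h t) -> 0 <= T -> RInt (fun t => Rabs (h t)) 0 T <= / w.
Proof.
  intros Hh. apply RInt_abs_impulse_limit with 0. intros t Ht.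
  rewrite RInt_abs_impulse_pos, step_defect_0; [|lra|intros; apply Hh; lra].
  pose proof (Rle_abs (step_defect t)). lra.
Qed.

(** The primitive climbs from [- / w] to [step_defect ts] and then descends to [0]; the value at the
    switch is travelled twice. *)
Lemma impulse_L1_switch (ts T : R) :
  0 <= ts -> (forall t, 0 <= t <= ts -> 0 <= h t) -> (forall t, ts <= t -> h t <= 0) ->
  0 <= T -> RInt (fun t => Rabs (h t)) 0 T <= / w + 2 * step_defect ts.
Proof.
  intros Hts Hp Hn. apply RInt_abs_impulse_limit with ts. intros t Ht.
  rewrite <- (RInt_Chasles _ 0 ts t) by apply ex_RInt_abs_impulse.
  change (@plus R_CompleteNormedModule) with Rplus.
  rewrite RInt_abs_impulse_pos, RInt_abs_impulse_neg, step_defect_0;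
    try lra; [|intros; apply Hn; lra|intros; apply Hp; lra].
  pose proof (Rle_abs (- step_defect t)) as H. rewrite Rabs_Ropp in H. lra.
Qed.

(** At a zero of [h] the velocity [K1] is [- K / sigma]. The middle factor is [sigma ^ 2] times the
    characteristic polynomial [s^2 + a s + w^2] at [s = -1 / sigma]. *)
Lemma step_defect_zero (ts : R) :
  0 < sigma -> h ts = 0 ->
  step_defect ts = K ts * (1 - a * sigma + w ^ 2 * sigma ^ 2) / (w * sigma).
Proof.
  intros Hs H0. unfold h, impulse_response in H0. unfold step_defect.
  apply Rmult_integral in H0. destruct H0 as [H0|H0]; [lra|].
  replace (K1 ts) with (- K ts / sigma).
  - field. lra.
  - apply (Rmult_eq_reg_l sigma); [|lra].
    replace (sigma * (- K ts / sigma)) with (- K ts) by (field; lra). lra.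
Qed.

End L1.

Lemma is_lim_exp_neg (c : R) : 0 < c -> is_lim (fun t => exp (- c * t)) p_infty 0.
Proof.
  intros Hc. apply is_lim_comp with m_infty.
  - apply is_lim_exp_m.
  - evar_last. apply is_lim_scal_l, is_lim_id. simpl.
    unfold Rbar_mult'. destruct Rle_dec; [exfalso; lra|reflexivity].
  - exists 0. discriminate.
Qed.

Lemma is_lim_mul_exp_neg (c : R) : 0 < c -> is_lim (fun t => t * exp (- c * t)) p_infty 0.
Proof.
  intros Hc.
  apply is_lim_ext with (fun t => - / c * (- c * t * exp (- c * t))).
  - intros t. field. lra.
  - replace (Finite 0) with (Rbar_mult (- / c) 0) by (simpl; f_equal; ring).
    apply is_lim_scal_l.
    apply (is_lim_comp (fun y => y * exp y) (fun t => - c * t) p_infty 0 m_infty).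
    + apply is_lim_mul_exp_m.
    + evar_last. apply is_lim_scal_l, is_lim_id. simpl.
      unfold Rbar_mult'. destruct Rle_dec; [exfalso; lra|reflexivity].
    + exists 0. discriminate.
Qed.

(** * Overdamped and critically damped modes *)


Section Overdamped.

Variables (a w D : R).
Hypothesis Hw : 0 < w.
Hypothesis Ha : 0 < a.
Hypothesis HD : 0 < D.
Hypothesis HD2 : D ^ 2 = a ^ 2 - 4 * w ^ 2.

Let p := (a + D) / 2.
Let q := (a - D) / 2.

Definition over_K (t : R) : R := (exp (- q * t) - exp (- p * t)) / D.
Definition over_K1 (t : R) : R := (p * exp (- p * t) - q * exp (- q * t)) / D.

Lemma over_roots : 0 < q /\ q < p /\ p * q = w ^ 2 /\ p + q = a /\ p - q = D.
Proof.
  assert (D < a) by nra. unfold p, q. repeat split; lra.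
Qed.

Lemma over_fundamental : fundamental_solution a w over_K over_K1.
Proof.
  destruct over_roots as (Hq & Hqp & Hpq & Hs & Hd).
  unfold fundamental_solution, over_K, over_K1.
  refine (conj _ (conj _ (conj _ (conj _ (conj _ _))))).
  - rewrite !Rmult_0_r, exp_0. field. lra.
  - rewrite !Rmult_0_r, exp_0. rewrite <- Hd. field. lra.
  - intros t. auto_derive; [lra|]. field. lra.
  - intros t. auto_derive; [lra|]. rewrite <- Hpq, <- Hs. field. lra.
  - apply is_lim_ext with (fun t => / D * exp (- q * t) - / D * exp (- p * t)).
    + intros t. field. lra.
    + replace (Finite 0) with (Finite (/ D * 0 - / D * 0)) by (f_equal; ring).
      apply is_lim_minus'.
      * apply (is_lim_scal_l _ (/ D) p_infty 0). apply is_lim_exp_neg; lra.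
      * apply (is_lim_scal_l _ (/ D) p_infty 0). apply is_lim_exp_neg; lra.
  - apply is_lim_ext with (fun t => p / D * exp (- p * t) - q / D * exp (- q * t)).
    + intros t. field. lra.
    + replace (Finite 0) with (Finite (p / D * 0 - q / D * 0)) by (f_equal; ring).
      apply is_lim_minus'.
      * apply (is_lim_scal_l _ (p / D) p_infty 0). apply is_lim_exp_neg; lra.
      * apply (is_lim_scal_l _ (q / D) p_infty 0). apply is_lim_exp_neg; lra.
Qed.

Lemma over_exp_le (t : R) : 0 <= t -> 0 < exp (- p * t) <= exp (- q * t).
Proof.
  destruct over_roots as (Hq & Hqp & _). intros Ht. split; [apply exp_pos|].
  destruct (Req_dec t 0) as [->|]; [rewrite !Rmult_0_r; lra|].
  left. apply exp_increasing. nra.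
Qed.

(** The condition [a <= 2 * D] makes the division by the root gap [D] cost only a constant. The
    combination [K1 + a K] is the kernel that multiplies the initial displacement in Duhamel's
    formula. *)
Lemma over_bounds (t : R) :
  a <= 2 * D -> 0 <= t ->
  Rabs (over_K t) <= 2 / a /\ Rabs (over_K1 t + a * over_K t) <= 2.
Proof.
  intros HaD Ht. destruct over_roots as (Hq & Hqp & Hpq & Hs & Hd).
  pose proof (over_exp_le t Ht) as He.
  assert (He1 : exp (- q * t) <= 1).
  { rewrite <- exp_0. destruct (Req_dec t 0) as [->|]; [rewrite Rmult_0_r; lra|].
    left. apply exp_increasing. nra. }
  set (x := exp (- p * t)) in *. set (y := exp (- q * t)) in *.
  unfold over_K, over_K1. fold x y. split.
  - rewrite Rabs_pos_eq by (apply Rdiv_le_0_compat; lra).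
    apply (Rmult_le_reg_r (a * D)); [nra|].
    replace ((y - x) / D * (a * D)) with ((y - x) * a) by (field; lra).
    replace (2 / a * (a * D)) with (2 * D) by (field; lra). nra.
  - replace ((p * x - q * y) / D + a * ((y - x) / D)) with ((p * y - q * x) / D)
      by (rewrite <- Hs; field; lra).
    rewrite Rabs_pos_eq by (apply Rdiv_le_0_compat; nra).
    apply (Rmult_le_reg_r D); [lra|].
    replace ((p * y - q * x) / D * D) with (p * y - q * x) by (field; lra). nra.
Qed.

Lemma over_response (sigma t : R) :
  impulse_response sigma w over_K over_K1 t
  = w / D * ((1 - sigma * q) * exp (- q * t) - (1 - sigma * p) * exp (- p * t)).
Proof. unfold impulse_response, over_K, over_K1. field. lra. Qed.

(** It suffices that [1 - sigma * q] is nonnegative, for it is the larger coefficient and multiplies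
    the slower exponential. In the first alternative the two coefficients have nonpositive product;
    in the second [p * q = w ^ 2] puts the smaller root below [1 / sigma]. *)
Lemma over_L1_pos (sigma T : R) :
  0 < sigma -> 1 - a * sigma + w ^ 2 * sigma ^ 2 <= 0 \/ w * sigma < 1 -> 0 <= T ->
  RInt (fun t => Rabs (impulse_response sigma w over_K over_K1 t)) 0 T <= / w.
Proof.
  intros Hs Hc. apply (impulse_L1_pos sigma a w over_K over_K1 Hw over_fundamental).
  intros t Ht. rewrite over_response.
  destruct over_roots as (Hq & Hqp & Hpq & Hsum & Hd). pose proof (over_exp_le t Ht) as He.
  assert (E : (1 - sigma * q) * (1 - sigma * p) = 1 - a * sigma + w ^ 2 * sigma ^ 2).
  { rewrite <- Hpq, <- Hsum. ring. }
  apply Rmult_le_pos; [apply Rdiv_le_0_compat; lra|].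
  assert (Hx : 0 <= 1 - sigma * q).
  { destruct Hc as [Hc|Hc].
    - rewrite <- E in Hc. assert (1 - sigma * p < 1 - sigma * q) by nra.
      destruct (Rle_dec 0 (1 - sigma * q)) as [|Hn]; [assumption|exfalso].
      set (X := 1 - sigma * q) in *. set (Y := 1 - sigma * p) in *. nra.
    - destruct (Rle_dec 0 (1 - sigma * q)) as [|Hn]; [assumption|exfalso].
      assert (1 < sigma * q) by lra. assert (sigma * q < sigma * p) by nra.
      assert (1 * 1 < (sigma * q) * (sigma * p)) by (apply Rmult_le_0_lt_compat; lra).
      replace (sigma * q * (sigma * p)) with ((w * sigma) ^ 2) in H1
        by (rewrite Rpow_mult_distr, <- Hpq; ring).
      assert (0 < w * sigma) by nra. nra. }
  assert (1 - sigma * p <= 1 - sigma * q) by nra. nra.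
Qed.

(** Both decay rates exceed [1 / sigma], so [h] starts positive and changes sign once, when
    [exp (D * t) = y / x]. Since [x * y = k ^ 2], this ratio is [(y / k) ^ 2], which produces the
    base [k / y] of the power. *)
Lemma over_L1_switch (sigma k T : R) :
  0 < sigma -> 0 < k -> k ^ 2 = 1 - a * sigma + w ^ 2 * sigma ^ 2 -> 1 <= w * sigma -> 0 <= T ->
  0 < sigma * p - 1 /\
  RInt (fun t => Rabs (impulse_response sigma w over_K over_K1 t)) 0 T
    <= / w * (1 + 2 * k * Rpower (k / (sigma * p - 1)) (a / D)).
Proof.
  intros Hs Hk Hk2 Hws HT.
  destruct over_roots as (Hq & Hqp & Hpq & Hsum & Hd).
  set (x := sigma * q - 1). set (y := sigma * p - 1).
  assert (Hxy : x * y = k ^ 2).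
  { unfold x, y. rewrite Hk2, <- Hpq, <- Hsum. ring. }
  assert (Hyx : y - x = sigma * D) by (unfold x, y; rewrite <- Hd; ring).
  assert (0 < sigma * D) by nra.
  assert (Hy : 0 < y).
  (* Otherwise [sigma * q < sigma * p <= 1], and their product [(w * sigma) ^ 2] would be less than
     [1]. *)
  { destruct (Rlt_dec 0 y) as [|Hn]; [assumption|exfalso].
    assert (H1 : 0 < sigma * q) by nra.
    assert (Hx0 : x < 0) by lra. assert (Hy0 : y < 0) by nra.
    assert (Hlt : (sigma * q) * (sigma * p) < 1 * 1).
    { apply Rmult_le_0_lt_compat; unfold x, y in *; try nra; lra. }
    replace (sigma * q * (sigma * p)) with ((w * sigma) ^ 2) in Hlt
      by (rewrite Rpow_mult_distr, <- Hpq; ring). nra. }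
  assert (Hx : 0 < x) by (assert (0 < x * y) by nra; nra).
  split; [exact Hy|].
  set (ts := ln (y / x) / D).
  assert (Hts : D * ts = ln (y / x)) by (unfold ts; field; lra).
  assert (Hyx1 : 1 < y / x).
  { apply (Rmult_lt_reg_r x); [lra|]. replace (y / x * x) with y by (field; lra). lra. }
  assert (Hts0 : 0 <= ts).
  { unfold ts. apply Rdiv_le_0_compat; [|lra]. rewrite <- ln_1. left. apply ln_increasing; lra. }
  assert (Hexp : exp (D * ts) = y / x) by (rewrite Hts; apply exp_ln; lra).
  assert (Hresp : forall t, impulse_response sigma w over_K over_K1 t
             = w / D * exp (- p * t) * (y - x * exp (D * t))).
  { intros t. rewrite over_response.
    replace (exp (- q * t)) with (exp (- p * t) * exp (D * t))
      by (rewrite <- exp_plus; f_equal; rewrite <- Hd; ring).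
    unfold x, y. ring. }
  assert (Hts_eq : x * exp (D * ts) = y) by (rewrite Hexp; field; lra).
  assert (Hmono : forall s t, s <= t -> exp (D * s) <= exp (D * t)).
  { intros s t [Hst| ->]; [|lra]. left. apply exp_increasing. nra. }
  assert (Hpos : forall t, 0 < w / D * exp (- p * t)).
  { intros t. apply Rmult_lt_0_compat; [apply Rdiv_lt_0_compat; lra|apply exp_pos]. }
  eapply Rle_trans.
  { apply (impulse_L1_switch sigma a w over_K over_K1 Hw over_fundamental ts T Hts0);
      [| |exact HT].
    - intros t Ht. rewrite Hresp. pose proof (Hmono t ts ltac:(lra)). pose proof (Hpos t).
      apply Rmult_le_pos; [lra|nra].
    - intros t Ht. rewrite Hresp. pose proof (Hmono ts t Ht). pose proof (Hpos t).
      assert (y - x * exp (D * t) <= 0) by nra. nra. }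
  rewrite step_defect_zero; [|assumption|assumption|].
  2:{ rewrite Hresp, Hts_eq. ring. }
  rewrite <- Hk2. right.
  assert (HKts : over_K ts = exp (- q * ts) * (sigma / y)).
  { unfold over_K. replace (exp (- p * ts)) with (exp (- q * ts) * / exp (D * ts)).
    - rewrite Hexp. replace sigma with ((y - x) / D) by (rewrite Hyx; field; lra). field. lra.
    - rewrite <- exp_Ropp, <- exp_plus. f_equal. rewrite <- Hd. ring. }
  assert (HR : Rpower (k / y) (a / D) = k / y * exp (- q * ts)).
  { assert (Hky : 0 < k / y) by (apply Rdiv_lt_0_compat; lra).
    (* This splitting isolates [exp (- q * ts)], because [ln (k / y)] is [- D * ts / 2]. *)
    replace (a / D) with (1 + 2 * (q / D)) by (rewrite <- Hsum, <- Hd; field; lra).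
    rewrite Rpower_plus, Rpower_1 by assumption. f_equal. unfold Rpower. f_equal.
    replace (ln (k / y)) with (- (1 / 2) * ln (y / x)).
    - rewrite <- Hts. field. lra.
    - assert (E : k / y * (k / y) = / (y / x)).
      { replace (k / y * (k / y)) with (k ^ 2 / (y * y)) by (field; lra).
        rewrite <- Hxy. field. lra. }
      apply (f_equal ln) in E. rewrite ln_mult, ln_Rinv in E by lra. lra. }
  rewrite HKts, HR. field. lra.
Qed.

End Overdamped.

Section Critical.

Variables (w : R).
Hypothesis Hw : 0 < w.

Definition crit_K (t : R) : R := t * exp (- w * t).
Definition crit_K1 (t : R) : R := (1 - w * t) * exp (- w * t).

Lemma crit_fundamental : fundamental_solution (2 * w) w crit_K crit_K1.
Proof.
  unfold fundamental_solution, crit_K, crit_K1.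
  refine (conj _ (conj _ (conj _ (conj _ (conj _ _))))).
  - ring.
  - rewrite !Rmult_0_r, exp_0. ring.
  - intros t. auto_derive; [trivial|ring].
  - intros t. auto_derive; [trivial|ring].
  - now apply is_lim_mul_exp_neg.
  - apply is_lim_ext with (fun t => exp (- w * t) - w * (t * exp (- w * t))).
    + intros t. ring.
    + replace (Finite 0) with (Finite (0 - w * 0)) by (f_equal; ring).
      apply is_lim_minus'; [now apply is_lim_exp_neg|].
      apply (is_lim_scal_l _ w p_infty 0). now apply is_lim_mul_exp_neg.
Qed.

Lemma crit_response (sigma t : R) :
  impulse_response sigma w crit_K crit_K1 t
  = w * exp (- w * t) * (sigma + (1 - sigma * w) * t).
Proof. unfold impulse_response, crit_K, crit_K1. ring. Qed.

Lemma crit_L1_pos (sigma T : R) :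
  0 < sigma -> w * sigma <= 1 -> 0 <= T ->
  RInt (fun t => Rabs (impulse_response sigma w crit_K crit_K1 t)) 0 T <= / w.
Proof.
  intros Hs Hc. apply (impulse_L1_pos sigma (2 * w) w crit_K crit_K1 Hw crit_fundamental).
  intros t Ht. rewrite crit_response. pose proof (exp_pos (- w * t)).
  apply Rmult_le_pos; nra.
Qed.

Lemma crit_L1_switch (sigma k T : R) :
  0 < sigma -> 0 < k -> w * sigma = 1 + k -> 0 <= T ->
  RInt (fun t => Rabs (impulse_response sigma w crit_K crit_K1 t)) 0 T
    <= / w * (1 + 2 * k * exp (- 1 - 1 / k)).
Proof.
  intros Hs Hk Hws HT.
  assert (Hresp : forall t, impulse_response sigma w crit_K crit_K1 t
             = w * exp (- w * t) * (sigma - k * t)).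
  { intros t. rewrite crit_response. replace (1 - sigma * w) with (- k) by lra. ring. }
  assert (Hkt : k * (sigma / k) = sigma) by (field; lra).
  assert (Hpos : forall t, 0 < w * exp (- w * t)).
  { intros t. apply Rmult_lt_0_compat; [lra|apply exp_pos]. }
  eapply Rle_trans.
  { apply (impulse_L1_switch sigma (2 * w) w crit_K crit_K1 Hw crit_fundamental (sigma / k) T);
      [apply Rdiv_le_0_compat; lra| | |exact HT].
    - intros t Ht. rewrite Hresp. pose proof (Hpos t). apply Rmult_le_pos; [lra|nra].
    - intros t Ht. rewrite Hresp. pose proof (Hpos t).
      assert (sigma - k * t <= 0) by nra. nra. }
  rewrite step_defect_zero; [|assumption|assumption|].
  2:{ rewrite Hresp, Hkt. ring. }
  right. unfold crit_K.
  (* The exponent of the kernel at the switch time [sigma / k], by [w * sigma = 1 + k]. *)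
  replace (- 1 - 1 / k) with (- w * (sigma / k)).
  2:{ replace (- w * (sigma / k)) with (- (w * sigma) / k) by (field; lra).
      rewrite Hws. field. lra. }
  replace (1 - 2 * w * sigma + w ^ 2 * sigma ^ 2) with (k ^ 2).
  2:{ replace (w ^ 2 * sigma ^ 2) with ((w * sigma) ^ 2) by ring.
      rewrite (Rmult_assoc 2 w), Hws. ring. }
  field. lra.
Qed.

End Critical.

(** * Underdamped modes and the gain of a mode *)


Section Underdamped.

Variables (a w nu : R).
Hypothesis Hw : 0 < w.
Hypothesis Ha : 0 < a.
Hypothesis Hnu : 0 < nu.
Hypothesis Hnu2 : 4 * nu ^ 2 = 4 * w ^ 2 - a ^ 2.

Let r := a / 2.

Definition under_K (t : R) : R := exp (- r * t) * sin (nu * t) / nu.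
Definition under_K1 (t : R) : R := exp (- r * t) * (cos (nu * t) - r / nu * sin (nu * t)).

Lemma under_decay (f : R -> R) (C : R) :
  (forall t, Rabs (f t) <= C) -> is_lim (fun t => exp (- r * t) * f t) p_infty 0.
Proof.
  intros Hf.
  assert (L : is_lim (fun t => C * exp (- r * t)) p_infty 0).
  { replace (Finite 0) with (Rbar_mult C 0) by (simpl; f_equal; ring).
    apply is_lim_scal_l, is_lim_exp_neg. unfold r; lra. }
  assert (L' : is_lim (fun t => - C * exp (- r * t)) p_infty 0).
  { replace (Finite 0) with (Rbar_mult (- C) 0) by (simpl; f_equal; ring).
    apply is_lim_scal_l, is_lim_exp_neg. unfold r; lra. }
  refine (is_lim_le_le_loc _ _ _ _ _ _ L' L).
  exists 0. intros t _. pose proof (Hf t) as H. apply Rabs_le_between in H.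
  pose proof (exp_pos (- r * t)). nra.
Qed.

Lemma under_fundamental : fundamental_solution a w under_K under_K1.
Proof.
  assert (Hr2 : w ^ 2 = nu ^ 2 + r ^ 2) by (unfold r; lra).
  assert (Hr : a = 2 * r) by (unfold r; lra).
  refine (conj _ (conj _ (conj _ (conj _ (conj _ _))))).
  - unfold under_K. rewrite !Rmult_0_r, sin_0. unfold Rdiv. ring.
  - unfold under_K1. rewrite !Rmult_0_r, sin_0, cos_0, exp_0. ring.
  - intros t. unfold under_K, under_K1. auto_derive; [lra|]. field. lra.
  - intros t. unfold under_K, under_K1. auto_derive; [lra|].
    rewrite Hr2, Hr. field. lra.
  - apply is_lim_ext with (fun t => exp (- r * t) * (sin (nu * t) / nu)).
    { intros t. unfold under_K. field. lra. }
    apply under_decay with (/ nu). intros t. unfold Rdiv. rewrite Rabs_mult.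
    rewrite (Rabs_pos_eq (/ nu)) by (left; apply Rinv_0_lt_compat; lra).
    assert (0 < / nu) by (apply Rinv_0_lt_compat; lra).
    assert (Rabs (sin (nu * t)) <= 1) by (apply Rabs_le, SIN_bound). nra.
  - apply under_decay with (1 + r / nu). intros t.
    assert (0 < r / nu) by (apply Rdiv_lt_0_compat; unfold r; lra).
    pose proof (SIN_bound (nu * t)). pose proof (COS_bound (nu * t)).
    apply Rabs_le. nra.
Qed.

Section Response.

Variables (sigma k : R).
Hypothesis Hs : 0 < sigma.
Hypothesis Hk : 0 < k.
Hypothesis Hk2 : k ^ 2 = 1 - a * sigma + w ^ 2 * sigma ^ 2.

Let h := impulse_response sigma w under_K under_K1.
Let phi := acos ((1 - sigma * r) / k).
Let P := PI / nu.

(** [k] and [phi] are the modulus and the argument of the complex number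
    [1 - sigma * r + i sigma nu]; they merge the sine and cosine parts of [K + sigma * K1] into one
    shifted sine. *)
Lemma under_phase :
  0 <= phi <= PI /\ k * cos phi = 1 - sigma * r /\ k * sin phi = sigma * nu.
Proof.
  assert (Hr : a = 2 * r) by (unfold r; lra).
  assert (Hr2 : w ^ 2 = nu ^ 2 + r ^ 2) by (unfold r; lra).
  assert (E : k ^ 2 = (1 - sigma * r) ^ 2 + (sigma * nu) ^ 2).
  { rewrite Hk2, Hr2, Hr. ring. }
  assert (Hsn : 0 < sigma * nu) by nra.
  assert (Hb : -1 <= (1 - sigma * r) / k <= 1).
  { assert (Hb : - k <= 1 - sigma * r <= k) by nra.
    split; apply (Rmult_le_reg_r k); try lra;
      replace ((1 - sigma * r) / k * k) with (1 - sigma * r) by (field; lra); lra. }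
  assert (Hphi : 0 <= phi <= PI) by apply acos_bound.
  assert (Hc : k * cos phi = 1 - sigma * r).
  { unfold phi. rewrite cos_acos by exact Hb. field. lra. }
  split; [exact Hphi|]. split; [exact Hc|].
  assert (H0 : 0 <= sin phi) by (apply sin_ge_0; lra).
  pose proof (sin2_cos2 phi) as Hsc. unfold Rsqr in Hsc.
  assert (H1 : 0 <= k * sin phi) by nra.
  assert (Hsq : (k * sin phi) ^ 2 = (sigma * nu) ^ 2).
  { replace ((k * sin phi) ^ 2)
      with (k ^ 2 * (sin phi * sin phi + cos phi * cos phi) - (k * cos phi) ^ 2) by ring.
    rewrite Hsc, Hc, E. ring. }
  nra.
Qed.

Lemma under_response (t : R) : h t = w * k / nu * exp (- r * t) * sin (nu * t + phi).
Proof.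
  destruct under_phase as (_ & Hc & Hsn). rewrite sin_plus.
  replace (w * k / nu * exp (- r * t) * (sin (nu * t) * cos phi + cos (nu * t) * sin phi))
    with (w / nu * exp (- r * t) * (sin (nu * t) * (k * cos phi) + cos (nu * t) * (k * sin phi)))
    by (field; lra).
  rewrite Hc, Hsn. unfold h, impulse_response, under_K, under_K1. field. lra.
Qed.

Lemma under_period_pos : 0 < P.
Proof. unfold P. apply Rdiv_lt_0_compat; [apply PI_RGT_0|lra]. Qed.

(** [P] is half a period of the sine. Successive half periods therefore contribute to the norm in
    geometric progression. *)
Lemma under_antiperiodic (t : R) : h (t + P) = - exp (- r * P) * h t.
Proof.
  rewrite !under_response.
  replace (nu * (t + P) + phi) with (nu * t + phi + PI) by (unfold P; field; lra).
  rewrite neg_sin. replace (- r * (t + P)) with (- r * t + - r * P) by ring.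
  rewrite exp_plus. ring.
Qed.

Lemma under_first_period :
  RInt (fun t => Rabs (h t)) 0 P
  = / w * (1 - exp (- r * P) + 2 * k * (exp (- r * P) * exp (r / nu * phi))).
Proof.
  destruct under_phase as (Hphi & Hc & Hsn). pose proof under_period_pos as HP.
  (* The one zero of [h] in the first half period: [nu * t + phi] reaches [PI] there. *)
  set (t0 := (PI - phi) / nu).
  assert (Hnt : nu * t0 = PI - phi) by (unfold t0; field; lra).
  assert (HnP : nu * P = PI) by (unfold P; field; lra).
  assert (Ht0 : 0 <= t0 <= P) by nra.
  assert (Hpos : forall t, 0 < w * k / nu * exp (- r * t)).
  { intros t. apply Rmult_lt_0_compat; [apply Rdiv_lt_0_compat; nra|apply exp_pos]. }
  unfold h in *.
  pose proof (ex_RInt_abs_impulse sigma a w _ _ under_fundamental) as Hex.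
  rewrite <- (RInt_Chasles _ 0 t0 P) by apply Hex.
  change (@plus R_CompleteNormedModule) with Rplus.
  rewrite (RInt_abs_impulse_pos sigma a w _ _ Hw under_fundamental 0 t0); [|lra|].
  2:{ intros t Ht. fold (h t). rewrite under_response.
      apply Rmult_le_pos; [left; apply Hpos|]. apply sin_ge_0; nra. }
  rewrite (RInt_abs_impulse_neg sigma a w _ _ Hw under_fundamental t0 P); [|lra|].
  2:{ intros t Ht. fold (h t). rewrite under_response.
      assert (sin (nu * t + phi) <= 0) by (apply sin_le_0; nra).
      pose proof (Hpos t). nra. }
  rewrite (step_defect_0 sigma a w _ _ Hw under_fundamental).
  rewrite (step_defect_zero sigma a w _ _ Hw t0); [|assumption|].
  2:{ fold (h t0). rewrite under_response, Hnt.
      replace (PI - phi + phi) with PI by ring. rewrite sin_PI. ring. }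
  rewrite <- Hk2.
  replace (under_K t0) with (exp (- r * P) * exp (r / nu * phi) * sigma / k).
  2:{ unfold under_K. rewrite Hnt, sin_PI_x.
      replace (sin phi) with (sigma * nu / k) by (rewrite <- Hsn; field; lra).
      rewrite <- exp_plus.
      replace (- r * P + r / nu * phi) with (- r * t0) by (unfold P, t0; field; lra).
      field. lra. }
  unfold step_defect, under_K, under_K1. rewrite HnP, sin_PI, cos_PI. real_eq. field. lra.
Qed.

Lemma under_L1 (T : R) :
  0 <= T ->
  RInt (fun t => Rabs (h t)) 0 T
    <= / w * (1 + 2 * k * (exp (r / nu * phi) / (exp (r / nu * PI) - 1))).
Proof.
  intros HT. pose proof under_period_pos as HP.
  pose proof (ex_RInt_abs_impulse sigma a w _ _ under_fundamental) as Hex. fold h in Hex.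
  set (E := exp (- r * P)).
  assert (HE : 0 < E < 1).
  { split; [apply exp_pos|]. rewrite <- exp_0. apply exp_increasing. unfold r. nra. }
  assert (HE' : exp (r / nu * PI) = / E).
  { unfold E. rewrite <- exp_Ropp. f_equal. unfold P. field. lra. }
  set (C := / w * (1 + 2 * k * (exp (r / nu * phi) / (exp (r / nu * PI) - 1)))).
  (* So [C] is the sum of the geometric series of ratio [E], and a bound [C] up to [n * P]
     reproduces itself as [(1 - E) * C + E * C] one half period later. *)
  assert (HC : RInt (fun t => Rabs (h t)) 0 P = (1 - E) * C).
  { rewrite under_first_period. fold E. unfold C. rewrite HE'. real_eq. field. lra. }
  assert (Hshift : forall t, RInt (fun s => Rabs (h s)) P (t + P)
                     = E * RInt (fun s => Rabs (h s)) 0 t).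
  { intros t.
    replace P with (1 * 0 + P) at 1 by ring. replace (t + P) with (1 * t + P) by ring.
    rewrite <- (RInt_comp_lin (V := R_CompleteNormedModule)) by apply Hex.
    rewrite <- (RInt_scal (V := R_CompleteNormedModule)) by apply Hex.
    apply RInt_ext. intros s _. rewrite Rmult_1_l, under_antiperiodic. fold E.
    unfold scal; simpl; unfold mult; simpl.
    rewrite Rabs_mult, Rabs_Ropp, (Rabs_pos_eq E), Rmult_1_l by lra. reflexivity. }
  assert (Hind : forall n : nat, RInt (fun s => Rabs (h s)) 0 (INR n * P) <= C).
  { induction n as [|n IH].
    - change (INR 0) with 0. rewrite Rmult_0_l.
      rewrite (RInt_point (V := R_CompleteNormedModule)).
      assert (0 <= (1 - E) * C); [|unfold zero; simpl; nra].
      rewrite <- HC. apply RInt_ge_0; [lra|apply Hex|]. intros; apply Rabs_pos.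
    - rewrite S_INR. replace ((INR n + 1) * P) with (INR n * P + P) by ring.
      rewrite <- (RInt_Chasles _ 0 P) by apply Hex.
      change (@plus R_CompleteNormedModule) with Rplus.
      rewrite Hshift, HC. nra. }
  destruct (INR_unbounded (T / P)) as [n Hn].
  eapply Rle_trans; [|apply (Hind n)].
  apply (RInt_abs_impulse_mono sigma a w _ _ under_fundamental). split; [exact HT|].
  left. apply (Rmult_lt_compat_r P) in Hn; [|exact HP].
  replace (T / P * P) with T in Hn by (field; lra). exact Hn.
Qed.

End Response.

End Underdamped.

(** * Gain of a mode across all damping regimes *)

Definition gain (mu sigma : R) (n : nat) : R :=
  if Rle_dec 1 (mu * sigma) then 1 else A mu sigma n.

(** The last clause isolates high frequencies: [4 <= w * sigma] gives [a >= 4 w], so the mode is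
    overdamped with [D >= a / 2], and its kernel obeys bounds with constants independent of [n].
    They feed the tail estimate. *)
Lemma mode_kernel (mu sigma : R) (n : nat) :
  0 < sigma -> 0 <= mu -> (1 <= n)%nat ->
  let w := INR n * PI in let a := damping mu sigma n in
  exists K K1, fundamental_solution a w K K1 /\
    (forall T, 0 <= T ->
       RInt (fun t => Rabs (impulse_response sigma w K K1 t)) 0 T <= gain mu sigma n / w) /\
    (4 <= w * sigma ->
       gain mu sigma n <= 3 /\
       forall t, 0 <= t -> Rabs (K t) <= 2 / a /\ Rabs (K1 t + a * K t) <= 2).
Proof.
  intros Hs Hm Hn w a.
  assert (Hn0 : 1 <= INR n) by (apply (le_INR 1); lia).
  pose proof PI2_3_2 as HPI.
  assert (Hw : 0 < w) by (unfold w; nra).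
  assert (Ea : a = mu + w ^ 2 * sigma) by (unfold a, w, damping; ring).
  assert (Ha : 0 < a) by (rewrite Ea; assert (0 < w ^ 2) by nra; nra).
  assert (Ek : 1 - a * sigma + w ^ 2 * sigma ^ 2 = 1 - mu * sigma) by (rewrite Ea; ring).
  (* Completing the square: the damping regime is read off from [(w * sigma - 1) ^ 2] against
     [1 - mu * sigma]. *)
  assert (Ed : sigma * (a - 2 * w) = (w * sigma - 1) ^ 2 - (1 - mu * sigma)).
  { rewrite Ea. ring. }
  assert (HD : 2 * w < a -> exists D, 0 < D /\ D ^ 2 = a ^ 2 - 4 * w ^ 2 /\
             D = sqrt (a ^ 2 - 4 * INR n ^ 2 * PI ^ 2)).
  { intros H. replace (4 * INR n ^ 2 * PI ^ 2) with (4 * w ^ 2) by (unfold w; ring).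
    assert (0 < a ^ 2 - 4 * w ^ 2) by nra.
    exists (sqrt (a ^ 2 - 4 * w ^ 2)). split; [now apply sqrt_lt_R0|].
    split; [apply pow2_sqrt; lra|reflexivity]. }
  assert (HaD : forall D, 0 < D -> D ^ 2 = a ^ 2 - 4 * w ^ 2 -> 4 <= w * sigma -> a <= 2 * D).
  { intros D D0 D2 H4. assert (4 * w <= a) by (rewrite Ea; nra).
    assert (4 * (4 * w ^ 2) <= a ^ 2) by nra. nra. }
  unfold gain. destruct (Rle_dec 1 (mu * sigma)) as [Hms|Hms].
  - assert (Hge : 2 * w <= a).
    { pose proof (pow2_ge_0 (w * sigma - 1)). apply Rnot_lt_le. intros Hlt.
      assert (0 < sigma * (2 * w - a)) by (apply Rmult_lt_0_compat; lra). lra. }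
    destruct Hge as [Hgt|Heq].
    + destruct (HD Hgt) as (D & D0 & D2 & _).
      exists (over_K a D), (over_K1 a D).
      split; [now apply over_fundamental|]. split.
      * intros T HT. unfold Rdiv. rewrite Rmult_1_l. apply over_L1_pos; auto. left. lra.
      * intros H4. split; [lra|]. intros t Ht. apply over_bounds with w; auto.
    + assert (Hws : w * sigma = 1).
      { rewrite <- Heq in Ed. assert ((w * sigma - 1) ^ 2 = 1 - mu * sigma) by lra. nra. }
      exists (crit_K w), (crit_K1 w). rewrite <- Heq.
      split; [now apply crit_fundamental|]. split.
      * intros T HT. unfold Rdiv. rewrite Rmult_1_l. apply crit_L1_pos; auto; lra.
      * intros H4. lra.
  - assert (Hms' : mu * sigma < 1) by lra.
    destruct (A_cases mu sigma n Hs Hm Hms' Hn) as (Hcov & _).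
    cbv zeta in Hcov. fold w in Hcov. fold a in Hcov.
    set (k := sqrt (1 - mu * sigma)) in *.
    assert (Hk : 0 < k) by (apply sqrt_lt_R0; lra).
    assert (Hk2' : k ^ 2 = 1 - mu * sigma) by (apply pow2_sqrt; lra).
    assert (Hk2 : k ^ 2 = 1 - a * sigma + w ^ 2 * sigma ^ 2) by lra.
    assert (Hk1 : k <= 1) by nra.
    assert (Hsi : 2 * w >= 2 * / sigma <-> w * sigma >= 1).
    { assert (sigma * / sigma = 1) by (field; lra).
      assert (0 < / sigma) by (apply Rinv_0_lt_compat; lra).
      split; intro; nra. }
    unfold A. fold w. fold a. fold k. cbv zeta.
    destruct (excluded_middle_informative _) as [C1|C1].
    + destruct C1 as [Hgt Hws]. apply Hsi in Hws.
      destruct (HD ltac:(lra)) as (D & D0 & D2 & ED).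
      exists (over_K a D), (over_K1 a D).
      split; [now apply over_fundamental|].
      assert (Hb : beta mu sigma n = a / D) by (unfold beta; fold a; now rewrite <- ED).
      rewrite Hb.
      (* The instance [T = 0] is taken for its first conclusion, which makes the denominators in
         [Er] nonzero. *)
      assert (Hy : 0 < sigma * ((a + D) / 2) - 1).
      { apply (over_L1_switch a w D Hw Ha D0 D2 sigma k 0); auto; lra. }
      assert (Er : 2 * (a / D) * k / (sigma * a * (1 + a / D) - 2 * (a / D))
                   = k / (sigma * ((a + D) / 2) - 1)).
      { field. repeat split; try lra.
        assert (0 < a * (sigma * ((a + D) / 2) - 1)) by (apply Rmult_lt_0_compat; lra). lra. }
      rewrite Er. split.
      * intros T HT. rewrite (Rdiv_def _ w), (Rmult_comm _ (/ w)).
        apply over_L1_switch; auto; lra.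
      * intros H4. split; [|intros t Ht; apply over_bounds with w; auto].
        assert (4 * w <= a) by (rewrite Ea; nra).
        (* The denominator is at least [2 * w * sigma - 1 >= 7] while [k <= 1]. With base at most
           [1] and positive exponent the power is at most [1], and the gain at most [1 + 2 = 3]. *)
        assert (Hkl : k / (sigma * ((a + D) / 2) - 1) <= 1).
        { apply (Rmult_le_reg_r (sigma * ((a + D) / 2) - 1)); [lra|].
          unfold Rdiv at 1. rewrite Rmult_assoc, Rinv_l by lra. nra. }
        assert (HR : Rpower (k / (sigma * ((a + D) / 2) - 1)) (a / D) <= 1).
        { assert (H0 : 0 < k / (sigma * ((a + D) / 2) - 1)) by (apply Rdiv_lt_0_compat; lra).
          unfold Rpower. apply Rle_trans with (exp 0); [|rewrite exp_0; lra].
          assert (Hl : ln (k / (sigma * ((a + D) / 2) - 1)) <= 0).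
          { rewrite <- ln_1. destruct Hkl as [Hl|Hl]; [left; now apply ln_increasing|].
            rewrite Hl. lra. }
          assert (0 < a / D) by (apply Rdiv_lt_0_compat; lra).
          destruct (Rle_lt_or_eq_dec (a / D * ln (k / (sigma * ((a + D) / 2) - 1))) 0)
            as [Hlt|Hlt]; [nra|left; now apply exp_increasing|rewrite Hlt; lra]. }
        assert (0 < Rpower (k / (sigma * ((a + D) / 2) - 1)) (a / D)) by apply exp_pos.
        set (Rp := Rpower _ _) in *.
        assert (k * Rp <= 1 * 1) by (apply Rmult_le_compat; lra).
        lra.
    + destruct (excluded_middle_informative _) as [C2|C2].
      * destruct C2 as [Hws Hge]. apply Rge_le in Hge. destruct Hge as [Hgt|Heq].
        -- destruct (HD Hgt) as (D & D0 & D2 & _).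
           exists (over_K a D), (over_K1 a D).
           split; [now apply over_fundamental|]. split; [|intros; lra].
           intros T HT. unfold Rdiv. rewrite Rmult_1_l. apply over_L1_pos; auto.
        -- exists (crit_K w), (crit_K1 w). rewrite <- Heq.
           split; [now apply crit_fundamental|]. split; [|intros; lra].
           intros T HT. unfold Rdiv. rewrite Rmult_1_l. apply crit_L1_pos; auto; lra.
      * destruct (excluded_middle_informative _) as [C3|C3].
        -- assert (Heq : a = 2 * w).
           { rewrite C3 in Ed. assert (sigma * (a - 2 * w) = 0) by (rewrite Ed; nra). nra. }
           exists (crit_K w), (crit_K1 w). rewrite Heq.
           split; [now apply crit_fundamental|]. split; [|intros; lra].
           intros T HT. rewrite (Rdiv_def _ w), (Rmult_comm _ (/ w)). apply crit_L1_switch; auto.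
        -- destruct (excluded_middle_informative _) as [C4|C4].
           2:{ exfalso. tauto. }
           assert (Hpos : 0 < 4 * w ^ 2 - a ^ 2) by nra.
           set (s := sqrt (4 * w ^ 2 - a ^ 2)).
           assert (Hs0 : 0 < s) by now apply sqrt_lt_R0.
           assert (Hs2 : s ^ 2 = 4 * w ^ 2 - a ^ 2) by (apply pow2_sqrt; lra).
           assert (Hnu : 0 < s / 2) by lra.
           assert (Hnu2 : 4 * (s / 2) ^ 2 = 4 * w ^ 2 - a ^ 2).
           { replace (4 * (s / 2) ^ 2) with (s ^ 2) by field. exact Hs2. }
           exists (under_K a (s / 2)), (under_K1 a (s / 2)).
           split; [now apply under_fundamental|]. split.
           (* [4 <= w * sigma] would give [a >= 4 w], against [a < 2 w]. *)
           2:{ intros H4. exfalso. rewrite Ea in C4. nra. }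
           intros T HT. rewrite (Rdiv_def _ w), (Rmult_comm _ (/ w)).
           replace (sigma * mu) with (mu * sigma) by ring. fold k.
           (* Since [a * sigma = mu * sigma + w ^ 2 * sigma ^ 2], the numerator is [2 - a * sigma],
              and the arccosine is the phase of the underdamped response. *)
           replace ((2 - mu * sigma - w ^ 2 * sigma ^ 2) / (2 * k))
             with ((1 - sigma * (a / 2)) / k).
           2:{ rewrite Ea. field. lra. }
           replace (a / s) with (a / 2 / (s / 2)) by (field; lra).
           replace (a * PI / s) with (a / 2 / (s / 2) * PI) by (field; lra).
           now apply under_L1.
Qed.

(** * Duhamel's formula *)


(* With [Psi s = K (t - s) (y' s - w sigma d s) + (K' + a K) (t - s) y s], the terms
   containing [d'] cancel and [Psi' s = h (t - s) d s], while [Psi t = y t]. *)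
Lemma duhamel_bound (sigma a w M : R) (K K1 y y1 y2 d d1 : R -> R) (t : R) :
  fundamental_solution a w K K1 ->
  (forall s, 0 < s -> is_derive y s (y1 s)) ->
  (forall s, 0 < s -> is_derive y1 s (y2 s)) ->
  (forall s, 0 < s -> is_derive d s (d1 s)) ->
  (forall s, 0 < s -> y2 s + a * y1 s + w ^ 2 * y s = w * (d s + sigma * d1 s)) ->
  (forall s, 0 < s -> Rabs (d s) <= M) ->
  1 <= t ->
  Rabs (y t) <=
    Rabs (K (t - 1) * (y1 1 - w * sigma * d 1) + (K1 (t - 1) + a * K (t - 1)) * y 1)
    + M * RInt (fun s => Rabs (impulse_response sigma w K K1 s)) 0 (t - 1).
Proof.
  intros HK Dy Dy1 Dd Heq HM Ht.
  pose proof HK as (K0 & K10 & DK & DK1 & _).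
  set (h := impulse_response sigma w K K1).
  assert (Ch : forall s, continuous h s) by (intros s; eapply impulse_continuous; eauto).
  set (Psi := fun s => K (t - s) * (y1 s - w * sigma * d s)
                       + (K1 (t - s) + a * K (t - s)) * y s).
  assert (DPsi : forall s, 0 < s -> is_derive Psi s (h (t - s) * d s)).
  { intros s Hs. unfold Psi.
    specialize (Dy s Hs). specialize (Dy1 s Hs). specialize (Dd s Hs). specialize (Heq s Hs).
    pose proof (DK (t - s)) as E0. pose proof (DK1 (t - s)) as E1.
    auto_derive.
    - repeat split; eexists; eassumption.
    - replace (Derive (fun x : R => K x) (t + - s)) with (K1 (t - s))
        by (symmetry; now apply is_derive_unique).
      replace (Derive (fun x : R => K1 x) (t + - s)) with (- a * K1 (t - s) - w ^ 2 * K (t - s))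
        by (symmetry; now apply is_derive_unique).
      replace (Derive (fun x : R => y x) s) with (y1 s) by (symmetry; now apply is_derive_unique).
      replace (Derive (fun x : R => y1 x) s) with (y2 s) by (symmetry; now apply is_derive_unique).
      replace (Derive (fun x : R => d x) s) with (d1 s) by (symmetry; now apply is_derive_unique).
      unfold h, impulse_response.
      replace (y2 s) with (w * (d s + sigma * d1 s) - a * y1 s - w ^ 2 * y s) by lra.
      change (t + - s) with (t - s). ring. }
  assert (Chs : forall s, continuous (fun s => h (t - s)) s).
  { intros s. apply continuous_comp; [|apply Ch].
    apply (ex_derive_continuous (V := R_NormedModule)). auto_derive. trivial. }
  (* Integration from [1] keeps the whole interval within the positive times where [Psi] is
     differentiable. *)
  assert (HI : is_RInt (fun s => h (t - s) * d s) 1 t (Psi t - Psi 1)).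
  { apply (is_RInt_derive (V := R_CompleteNormedModule) Psi);
      rewrite Rmin_left, Rmax_right by lra; intros s Hs.
    - apply DPsi; lra.
    - apply (continuous_mult (K := R_AbsRing)); [apply Chs|].
      apply (ex_derive_continuous (V := R_NormedModule)). exists (d1 s). apply Dd; lra. }
  assert (Cabs : forall s, continuous (fun s => Rabs (h s)) s).
  { intros s. apply (continuous_comp h Rabs); [apply Ch|apply continuous_Rabs]. }
  assert (Xabs : forall b c, ex_RInt (fun s => Rabs (h s)) b c).
  { intros b c. apply (ex_RInt_continuous (V := R_CompleteNormedModule)). intros; apply Cabs. }
  assert (Xrev : ex_RInt (fun s => Rabs (h (t - s))) 1 t).
  { apply (ex_RInt_continuous (V := R_CompleteNormedModule)). intros s _.
    apply (continuous_comp (fun s => h (t - s)) Rabs); [apply Chs|apply continuous_Rabs]. }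
  assert (Erev : RInt (fun s => Rabs (h (t - s))) 1 t = RInt (fun s => Rabs (h s)) 0 (t - 1)).
  { pose proof (RInt_comp_lin (V := R_CompleteNormedModule) (fun s => Rabs (h s)) (-1) t 1 t
      (Xabs _ _)) as E.
    replace (-1 * 1 + t) with (t - 1) in E by ring. replace (-1 * t + t) with 0 in E by ring.
    rewrite <- (opp_RInt_swap (V := R_CompleteNormedModule) _ (t - 1) 0) by apply Xabs.
    rewrite <- E, (RInt_ext (fun s => scal (-1) (Rabs (h (-1 * s + t))))
                     (fun s => scal (-1) (Rabs (h (t - s))))).
    - rewrite (RInt_scal (V := R_CompleteNormedModule)) by exact Xrev.
      unfold opp, scal; simpl; unfold mult; simpl. real_eq. lra.
    - intros s _. replace (-1 * s + t) with (t - s) by ring. reflexivity. }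
  assert (Psit : Psi t = y t).
  { unfold Psi. replace (t - t) with 0 by ring. rewrite K0, K10. ring. }
  assert (Hb : Rabs (Psi t - Psi 1) <= M * RInt (fun s => Rabs (h s)) 0 (t - 1)).
  { rewrite <- Erev.
    rewrite <- (RInt_scal (V := R_CompleteNormedModule)) by exact Xrev.
    rewrite <- (is_RInt_unique (V := R_CompleteNormedModule) _ _ _ _ HI).
    eapply Rle_trans; [apply abs_RInt_le; [lra|eexists; exact HI]|].
    apply RInt_le; [lra| | |].
    - apply (ex_RInt_norm (fun s => h (t - s) * d s)). eexists; exact HI.
    - apply (ex_RInt_scal (V := R_NormedModule)). exact Xrev.
    - intros s Hs. unfold scal; simpl; unfold mult; simpl. rewrite Rabs_mult.
      specialize (HM s ltac:(lra)). pose proof (Rabs_pos (h (t - s))). nra. }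
  rewrite Psit in Hb.
  replace (y t) with (Psi 1 + (y t - Psi 1)) by ring.
  eapply Rle_trans; [apply Rabs_triang|]. apply Rplus_le_compat; [|exact Hb].
  right. reflexivity.
Qed.

(** * Modes of a solution *)


Lemma is_derive_on_interior (D : R -> Prop) (f : R -> R) (x l : R) :
  locally x D -> is_derive_on D f x l -> is_derive f x l.
Proof.
  intros HD [Hlin Hdom]. split; [exact Hlin|].
  intros x0 Hx0 eps.
  (* The trace filter is finer, so it converges wherever [locally x] does. *)
  assert (H : is_filter_lim (within D (locally x)) x0).
  { intros P HP. specialize (Hx0 P HP). unfold within. apply filter_imp with (2 := Hx0). auto. }
  specialize (Hdom x0 H eps). unfold within in Hdom.
  generalize (filter_and _ _ HD Hdom). apply filter_imp. intros y [H1 H2]. auto.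
Qed.

Lemma locally_positive (t : R) : 0 < t -> locally t (fun s => 0 < s).
Proof. intros Ht. apply (locally_interval _ t 0 p_infty); simpl; auto. Qed.

Lemma is_derive_on_unit (f : R -> R) (x l : R) :
  0 < x < 1 -> is_derive_on unit_interval f x l -> is_derive f x l.
Proof.
  intros Hx. apply is_derive_on_interior.
  apply filter_imp with (2 := locally_interior 0 1 x Hx). intros y Hy. split; lra.
Qed.

Lemma is_derive_on_half_line (f : R -> R) (t l : R) :
  0 < t -> is_derive_on half_line f t l -> is_derive f t l.
Proof.
  intros Ht. apply is_derive_on_interior.
  apply filter_imp with (2 := locally_positive t Ht). intros y Hy. red; lra.
Qed.

Lemma is_derive_on_continuous (f f1 : R -> R) :
  (forall x, unit_interval x -> is_derive_on unit_interval f x (f1 x)) -> continuous_unit f.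
Proof.
  intros Hf. apply continuous_on_unit. intros x Hx.
  apply (filterdiff_continuous_aux (V := R_NormedModule)).
  - eexists. apply (Hf x Hx).
  - intros P HP. unfold within. apply filter_imp with (2 := HP). auto.
Qed.

Lemma is_Dt_derive (v vt : R -> R -> R) (t x : R) :
  is_Dt v vt -> 0 < t -> 0 <= x <= 1 -> is_derive (fun s => v s x) t (vt t x).
Proof.
  intros H Ht Hx. apply is_derive_on_half_line; [exact Ht|]. apply H.
  split; [red; simpl; lra|exact Hx].
Qed.

Lemma is_Dx_derive (v vx : R -> R -> R) (t x : R) :
  is_Dx v vx -> 0 < t -> 0 < x < 1 -> is_derive (v t) x (vx t x).
Proof.
  intros H Ht Hx. apply is_derive_on_unit; [exact Hx|]. apply H.
  split; [red; simpl; lra|red; simpl; lra].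
Qed.

(** Time stays positive near [t], so clamping the space variable alone turns continuity relative to
    the strip into continuity on a full neighbourhood in the plane. *)
Lemma C0_strip_clamp (v : R -> R -> R) (t x : R) :
  C0_strip v -> 0 < t ->
  filterlim (fun z : R * R => v (fst z) (clamp (snd z))) (locally (t, x))
            (locally (v t (clamp x))).
Proof.
  intros Hv Ht.
  apply (filterlim_comp _ _ _ (fun z : R * R => (fst z, clamp (snd z)))
           (fun p => v (fst p) (snd p)) _ (within strip (locally (t, clamp x)))).
  - intros P HP. unfold within in HP.
    assert (H1 : filterlim (fun z : R * R => (fst z, clamp (snd z)))
                   (locally (t, x)) (locally (t, clamp x))).
    { apply (continuous_comp_2 (fun z : R * R => fst z) (fun z => clamp (snd z)) (fun b c => (b, c))).
      - apply continuous_fst.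
      - apply (continuous_comp snd clamp); [apply continuous_snd|apply continuous_clamp].
      - apply continuous_ext with (fun z => z); [intros [? ?]; reflexivity|apply continuous_id]. }
    specialize (H1 _ HP). unfold filtermap in *.
    assert (H2 : locally (t, x) (fun z : R * R => 0 < fst z)).
    { apply (continuous_fst t x (fun s => 0 < s)). now apply locally_positive. }
    generalize (filter_and _ _ H1 H2). apply filter_imp.
    intros [s z] [Hz Hs]. apply Hz. split; [red; simpl in *; lra|apply clamp_unit].
  - apply (Hv (t, clamp x)). split; [red; simpl; lra|apply clamp_unit].
Qed.

Lemma C0_strip_slice (v : R -> R -> R) (t : R) :
  C0_strip v -> 0 < t -> continuous_unit (v t).
Proof.
  intros Hv Ht x.
  apply (filterlim_comp _ _ _ (fun y => (t, y))
           (fun z : R * R => v (fst z) (clamp (snd z))) _ (locally (t, x))).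
  - apply (continuous_comp_2 (fun _ : R => t) (fun y : R => y) (fun b c => (b, c)) x).
    + apply continuous_const.
    + apply continuous_id.
    + apply continuous_ext with (fun z => z); [intros [? ?]; reflexivity|apply continuous_id].
  - now apply C0_strip_clamp.
Qed.

Lemma sine_coef_clamp (f : R -> R) (n : nat) :
  sine_coef (fun x => f (clamp x)) n = sine_coef f n.
Proof. apply sine_coef_ext. intros x Hx. now rewrite clamp_id by lra. Qed.

Lemma sine_coef_bound (f : R -> R) (F : R) (n : nat) :
  continuous_unit f -> (forall x, 0 <= x <= 1 -> Rabs (f x) <= F) ->
  Rabs (sine_coef f n) <= F.
Proof.
  intros Cf HF. replace F with ((1 - 0) * F) by ring.
  apply abs_RInt_le_const; [lra|now apply ex_RInt_sine|].
  intros x Hx. rewrite Rabs_mult. pose proof (HF x Hx).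
  assert (Rabs (sin (INR n * PI * x)) <= 1) by (apply Rabs_le, SIN_bound).
  pose proof (Rabs_pos (f x)). pose proof (Rabs_pos (sin (INR n * PI * x))). nra.
Qed.

(** Differentiation under the integral sign. The integrand is clamped in [x] so that joint
    continuity holds around the endpoints as well, where [v] is controlled from one side only. *)
Lemma sine_coef_derive (v vt : R -> R -> R) (n : nat) (t : R) :
  is_Dt v vt -> C0_strip v -> C0_strip vt -> 0 < t ->
  is_derive (fun s => sine_coef (v s) n) t (sine_coef (vt t) n).
Proof.
  intros HD Cv Cvt Ht. set (w := INR n * PI).
  set (f := fun s x => v s (clamp x) * sin (w * x)).
  assert (Df : forall s x, 0 < s -> is_derive (fun z => f z x) s (vt s (clamp x) * sin (w * x))).
  { intros s x Hs. unfold f.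
    apply (is_derive_scal_l (K := R_AbsRing) (V := R_NormedModule) (fun z => v z (clamp x))).
    apply is_Dt_derive; [exact HD|exact Hs|apply clamp_unit]. }
  apply is_derive_ext with (fun s => RInt (fun x => f s x) 0 1).
  { intros s. apply (sine_coef_clamp (v s) n). }
  replace (sine_coef (vt t) n) with (RInt (fun x => Derive (fun z => f z x) t) 0 1).
  2:{ rewrite <- sine_coef_clamp. apply RInt_ext. intros x _.
      apply is_derive_unique. now apply Df. }
  apply is_derive_RInt_param.
  - apply filter_imp with (2 := locally_positive t Ht). intros s Hs x _.
    eexists. now apply Df.
  - intros x _.
    apply continuity_2d_pt_ext_loc with (fun s x => vt s (clamp x) * sin (w * x)).
    + destruct (locally_positive t Ht) as [e He]. exists e.
      intros s z Hs _. symmetry. apply is_derive_unique, Df, He. exact Hs.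
    + apply continuity_2d_pt_mult.
      * apply continuity_2d_pt_filterlim. now apply C0_strip_clamp.
      * apply continuity_2d_pt_filterlim.
        apply (continuous_comp snd (fun x => sin (w * x)) (t, x));
          [apply continuous_snd|apply continuous_sin_scal].
  - apply filter_imp with (2 := locally_positive t Ht). intros s Hs.
    apply (ex_RInt_continuous (V := R_CompleteNormedModule)). intros x _.
    apply (continuous_mult (K := R_AbsRing)).
    + now apply C0_strip_slice.
    + apply continuous_sin_scal.
Qed.

Lemma solution_modes (sigma mu : R) (f g d : R -> R) (u : R -> R -> R) :
  is_solution sigma mu f g d u ->
  exists (ut : R -> R -> R) (d1 : R -> R) (y2 : nat -> R -> R),
    (forall t, 0 < t -> is_derive d t (d1 t)) /\
    (forall t, 0 < t -> continuous_unit (ut t)) /\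
    (forall n t, 0 < t -> is_derive (fun s => sine_coef (u s) n) t (sine_coef (ut t) n)) /\
    (forall n t, 0 < t -> is_derive (fun s => sine_coef (ut s) n) t (y2 n t)) /\
    (forall n t, 0 < t ->
       y2 n t + damping mu sigma n * sine_coef (ut t) n
       + (INR n * PI) ^ 2 * sine_coef (u t) n
       = INR n * PI * (d t + sigma * d1 t)).
Proof.
  intros ((C0u & ut & ux & Hut & Hux & C1ut & C1ux) & (ut' & Hut' & C2ut' & _) & _ & Hwave & Hd & H1).
  destruct C1ut as (C0ut & utt & _ & Hutt & _ & C0utt & _).
  destruct C1ux as (C0ux & _ & uxx & _ & Huxx & _ & C0uxx).
  (* Two time derivatives are at hand, one jointly regular and one with [C2] slices; by uniqueness
     they agree at positive times and share both properties. *)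
  assert (Eut : forall t x, 0 < t -> 0 <= x <= 1 -> ut' t x = ut t x).
  { intros t x Ht Hx.
    rewrite <- (is_derive_unique _ _ _ (is_Dt_derive u ut' t x Hut' Ht Hx)).
    apply is_derive_unique. now apply is_Dt_derive. }
  (* Differentiates both boundary conditions in time: [x = 0] identifies [d'] with the trace of
     [ut], and [x = 1] gives the zero trace required for [ut]. *)
  assert (Dboundary : forall c t x, 0 <= x <= 1 -> (forall s, 0 <= s -> u s x = c s) ->
            0 < t -> is_derive c t (ut t x)).
  { intros c t x Hx Hc Ht. apply is_derive_ext_loc with (fun s => u s x).
    - apply filter_imp with (2 := locally_positive t Ht). intros s Hs. apply Hc; lra.
    - now apply is_Dt_derive. }
  exists ut, (fun t => ut t 0), (fun n t => sine_coef (utt t) n).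
  split; [intros t Ht; apply (Dboundary d t 0); auto; lra|].
  split; [intros t Ht; now apply C0_strip_slice|].
  split; [intros n t Ht; now apply sine_coef_derive|].
  split; [intros n t Ht; now apply sine_coef_derive|].
  intros n t Ht.
  destruct (C2ut' t ltac:(lra)) as (f1 & f2 & Hf1 & Hf2 & Cf2).
  assert (D1 : forall x, 0 < x < 1 -> is_derive (ut t) x (f1 x)).
  { intros x Hx. apply is_derive_ext_loc with (ut' t).
    - apply filter_imp with (2 := locally_interior 0 1 x Hx). intros y Hy. apply Eut; lra.
    - apply is_derive_on_unit; [exact Hx|]. apply Hf1. red; lra. }
  assert (D2 : forall x, 0 < x < 1 -> is_derive f1 x (f2 x)).
  { intros x Hx. apply is_derive_on_unit; [exact Hx|]. apply Hf2. red; lra. }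
  assert (Hut1 : ut t 1 = 0).
  { assert (D := Dboundary (fun _ => 0) t 1 ltac:(lra) H1 Ht).
    apply is_derive_unique in D. rewrite Derive_const in D. now symmetry. }
  assert (E2 := sine_coef_derive2 (ut t) f1 f2 n D1 D2
    (C0_strip_slice ut t C0ut Ht) (is_derive_on_continuous f1 f2 Hf2)
    (continuous_on_unit f2 Cf2) Hut1).
  assert (E0 := sine_coef_derive2 (u t) (ux t) (uxx t) n
    (fun x => is_Dx_derive u ux t x Hux Ht) (fun x => is_Dx_derive ux uxx t x Huxx Ht)
    (C0_strip_slice u t C0u Ht) (C0_strip_slice ux t C0ux Ht) (C0_strip_slice uxx t C0uxx Ht)
    (H1 t ltac:(lra))).
  assert (Epde : forall x, 0 < x < 1 ->
            utt t x = uxx t x + (sigma * f2 x + - mu * ut t x)).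
  { intros x Hx.
    assert (Ltt : Derive_n (fun s => u s x) 2 t = utt t x).
    { simpl. rewrite (Derive_ext_loc _ (fun s => ut s x)).
      - apply is_derive_unique. apply is_Dt_derive; [exact Hutt|exact Ht|lra].
      - apply filter_imp with (2 := locally_positive t Ht). intros s Hs.
        apply is_derive_unique. apply is_Dt_derive; [exact Hut|exact Hs|lra]. }
    assert (Lxx : Derive_n (fun y => u t y) 2 x = uxx t x).
    { simpl. rewrite (Derive_ext_loc _ (ux t)).
      - apply is_derive_unique. now apply is_Dx_derive.
      - apply filter_imp with (2 := locally_interior 0 1 x Hx). intros y Hy.
        apply is_derive_unique. now apply is_Dx_derive. }
    assert (Ltxx : Derive_n (fun y => Derive (fun s => u s y) t) 2 x = f2 x).
    { rewrite (Derive_n_ext_loc _ (ut t)).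
      - simpl. rewrite (Derive_ext_loc _ f1).
        + apply is_derive_unique. now apply D2.
        + apply filter_imp with (2 := locally_interior 0 1 x Hx). intros y Hy.
          apply is_derive_unique. now apply D1.
      - apply filter_imp with (2 := locally_interior 0 1 x Hx). intros y Hy.
        apply is_derive_unique. apply is_Dt_derive; [exact Hut|exact Ht|lra]. }
    pose proof (Hwave t x Ht Hx) as W. rewrite Ltt, Lxx, Ltxx in W. rewrite W.
    replace (Derive (fun s => u s x) t) with (ut t x); [ring|].
    symmetry. apply is_derive_unique. apply is_Dt_derive; [exact Hut|exact Ht|lra]. }
  rewrite (sine_coef_ext _ _ n Epde).
  pose proof (C0_strip_slice ut t C0ut Ht) as Cut.
  pose proof (C0_strip_slice uxx t C0uxx Ht) as Cuxx.
  pose proof (continuous_on_unit f2 Cf2) as Cf2'.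
  rewrite sine_coef_plus, sine_coef_plus, !sine_coef_scal;
    try assumption; try (apply continuous_unit_scal; assumption);
    [|apply continuous_unit_plus; apply continuous_unit_scal; assumption].
  rewrite E2, E0, <- Hd by lra. unfold damping. ring.
Qed.

Lemma solution_slice (sigma mu : R) (f g d : R -> R) (u : R -> R -> R) (t : R) :
  is_solution sigma mu f g d u -> 0 < t ->
  continuous_unit (u t) /\
  exists ux, (forall x, 0 < x < 1 -> is_derive (u t) x (ux x)) /\ continuous_unit ux.
Proof.
  intros ((C0u & _ & ux & _ & Hux & _ & C0ux & _) & _) Ht.
  split; [now apply C0_strip_slice|]. exists (ux t). split.
  - intros x Hx. now apply is_Dx_derive.
  - now apply C0_strip_slice.
Qed.

(** * Asymptotic bound *)


(** [Series] takes the default value [0] on sums diverging to infinity; the bound [B] supplies the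
    convergence that makes the comparison meaningful. *)
Lemma nonneg_series_bound (a : nat -> R) (B : R) (N : nat) :
  (forall n, 0 <= a n) -> (forall n, sum_n a n <= B) -> sum_n a N <= Series a.
Proof.
  intros Ha HB.
  assert (Hincr : forall n, sum_n a n <= sum_n a (S n)).
  { intros n. rewrite sum_n_S. specialize (Ha (S n)). lra. }
  revert N. apply is_lim_seq_incr_compare; [|exact Hincr].
  apply Lim_seq_correct'. now apply ex_finite_lim_seq_incr with B.
Qed.

Lemma sum_n_shift (a : nat -> R) (N : nat) :
  sum_n a (S N) = a 0%nat + sum_n (fun k => a (S k)) N.
Proof.
  induction N as [|N IH].
  - rewrite sum_n_S, !sum_n_O. reflexivity.
  - rewrite sum_n_S, IH, (sum_n_S (fun k => a (S k))). real_eq. ring.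
Qed.

Lemma mode_frequency_ge (n : nat) : INR n <= INR n * PI.
Proof. pose proof PI2_3_2. pose proof (pos_INR n). nra. Qed.

Lemma exists_large_mode (sigma : R) :
  0 < sigma ->
  exists N0, (1 <= N0)%nat /\ forall n, (N0 <= n)%nat -> 4 <= INR n * PI * sigma.
Proof.
  intros Hs. destruct (INR_unbounded (4 / sigma)) as [N HN].
  exists (S N). split; [lia|]. intros n Hn.
  assert (INR N <= INR n) by (apply le_INR; lia).
  apply Rle_trans with (4 / sigma * sigma); [right; field; lra|].
  apply Rmult_le_compat_r; [lra|]. pose proof (mode_frequency_ge n). lra.
Qed.

(* Equal to [0] for [n = 0], since [/ 0 = 0]. *)
Definition amplitude (mu sigma : R) (n : nat) : R := gain mu sigma n / (INR n * PI).

(** Nonnegativity comes from the norm bound at [T = 0], which reads [0 <= gain / w]; no inspection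
    of the formulas for [A] is involved. *)
Lemma gain_abs_le (mu sigma : R) (n : nat) :
  0 < sigma -> 0 <= mu -> (1 <= n)%nat -> 4 <= INR n * PI * sigma ->
  Rabs (gain mu sigma n) <= 3.
Proof.
  intros Hs Hm Hn H4.
  destruct (mode_kernel mu sigma n Hs Hm Hn) as (K & K1 & _ & HL & Hlarge).
  destruct (Hlarge H4) as [H3 _]. specialize (HL 0 ltac:(lra)).
  rewrite (RInt_point (V := R_CompleteNormedModule)) in HL.
  change (0 <= gain mu sigma n / (INR n * PI)) in HL.
  assert (Hw : 0 < INR n * PI).
  { pose proof (mode_frequency_ge n). pose proof (lt_0_INR n ltac:(lia)). lra. }
  apply Rabs_le. split; [|exact H3].
  apply (Rmult_le_compat_r (INR n * PI)) in HL; [|lra].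
  replace (gain mu sigma n / (INR n * PI) * (INR n * PI)) with (gain mu sigma n) in HL
    by (field; split; [apply PI_neq0|intros E; rewrite E in Hw; lra]).
  lra.
Qed.

Lemma sum_amplitude_bounded (mu sigma : R) :
  0 < sigma -> 0 <= mu ->
  exists B, forall N, sum_n (fun n => amplitude mu sigma n ^ 2) N <= B.
Proof.
  intros Hs Hm. destruct (exists_large_mode sigma Hs) as (N0 & HN0 & Hlarge).
  exists (sum_n (fun n => amplitude mu sigma n ^ 2) N0 + 3 ^ 2 * (/ INR N0)).
  intros N. eapply Rle_trans.
  { apply (sum_n_nonneg_mono _ N (N0 + N)); [intros; apply pow2_ge_0|lia]. }
  eapply Rle_trans; [apply (sum_n_sqr_tail _ 3); [lia|]|].
  - intros n Hn. unfold amplitude. unfold Rdiv. rewrite Rabs_mult.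
    assert (Hn1 : 0 < INR n) by (apply lt_0_INR; lia).
    pose proof (mode_frequency_ge n).
    rewrite (Rabs_pos_eq (/ (INR n * PI))) by (left; apply Rinv_0_lt_compat; lra).
    apply Rmult_le_compat; [apply Rabs_pos|left; apply Rinv_0_lt_compat; lra| |].
    + apply gain_abs_le; auto; [lia|]. apply Hlarge; lia.
    + apply Rinv_le_contravar; lra.
  - assert (0 < / INR (N0 + N)) by (apply Rinv_0_lt_compat, lt_0_INR; lia). lra.
Qed.

Lemma G_nonneg (mu sigma : R) : 0 <= G mu sigma.
Proof.
  unfold G. destruct Rle_dec.
  - apply Rdiv_le_0_compat; [lra|apply sqrt_lt_R0; lra].
  - apply Rmult_le_pos; [|apply sqrt_pos]. left. apply Rdiv_lt_0_compat; [lra|apply PI_RGT_0].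
Qed.

Lemma sum_amplitude_le_G (mu sigma : R) (N : nat) :
  0 < sigma -> 0 <= mu ->
  2 * sum_n (fun n => amplitude mu sigma n ^ 2) N <= G mu sigma ^ 2.
Proof.
  intros Hs Hm. destruct (sum_amplitude_bounded mu sigma Hs Hm) as [B HB].
  unfold amplitude, gain, G in *. destruct (Rle_dec 1 (mu * sigma)) as [Hc|Hc].
  (* All gains are [1] here and the sum of [1 / (n PI)^2] is at most [1 / 6]: the origin of
     [1 / sqrt 3]. *)
  - replace ((1 / sqrt 3) ^ 2) with (1 / 3); [apply sum_inv_sq_le|].
    unfold Rdiv. rewrite Rpow_mult_distr, pow_inv, pow2_sqrt by lra. ring.
  - set (a := fun n => (A mu sigma n / (INR n * PI)) ^ 2) in *.
    set (c := fun k => / INR (S k) ^ 2 * A mu sigma (S k) ^ 2).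
    pose proof PI_RGT_0 as HPI.
    assert (Ea : forall k, a (S k) = (/ PI) ^ 2 * c k).
    { intros k. unfold a, c. assert (0 < INR (S k)) by (apply lt_0_INR; lia). field. lra. }
    (* The series in [G] starts with mode [1], the amplitudes with index [0], whose term
       vanishes. *)
    assert (E : forall n, sum_n a (S n) = (/ PI) ^ 2 * sum_n c n).
    { intros n. rewrite sum_n_shift, (sum_n_Rext _ (fun k => (/ PI) ^ 2 * c k)) by exact Ea.
      rewrite sum_n_Rmult_l. unfold a. change (INR 0) with 0. rewrite Rmult_0_l.
      unfold Rdiv. rewrite Rinv_0. real_eq. ring. }
    assert (Hc0 : forall k, 0 <= c k).
    { intros k. unfold c. apply Rmult_le_pos; [|apply pow2_ge_0].
      left. apply Rinv_0_lt_compat, pow_lt, lt_0_INR. lia. }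
    assert (Hc1 : forall n, sum_n c n <= Series c).
    { intros n. apply nonneg_series_bound with (PI ^ 2 * B); [exact Hc0|].
      intros m. specialize (HB (S m)). rewrite E in HB.
      apply (Rmult_le_compat_l (PI ^ 2)) in HB; [|apply pow2_ge_0].
      rewrite <- Rmult_assoc in HB.
      replace (PI ^ 2 * (/ PI) ^ 2) with 1 in HB by (field; lra). rewrite Rmult_1_l in HB.
      exact HB. }
    eapply Rle_trans.
    { apply Rmult_le_compat_l; [lra|]. apply (sum_n_nonneg_mono a N (S N)); [|lia].
      intros; apply pow2_ge_0. }
    rewrite E, Rpow_mult_distr, pow2_sqrt.
    + replace ((1 / PI) ^ 2) with ((/ PI) ^ 2) by (field; lra).
      specialize (Hc1 N). pose proof (pow2_ge_0 (/ PI)). nra.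
    + specialize (Hc1 0%nat). rewrite sum_n_O in Hc1. specialize (Hc0 0%nat). lra.
Qed.

Section Asymptotics.

Variables (sigma mu M : R) (f g d : R -> R) (u : R -> R -> R).
Hypothesis Hs : 0 < sigma.
Hypothesis Hm : 0 <= mu.
Hypothesis HM : forall t, 0 <= t -> Rabs (d t) <= M.
Hypothesis Hu : is_solution sigma mu f g d u.

Lemma mode_eventually (n : nat) (eps : R) :
  (1 <= n)%nat -> 0 < eps ->
  exists T, 1 <= T /\
    forall t, T <= t -> Rabs (sine_coef (u t) n) <= amplitude mu sigma n * M + eps.
Proof.
  intros Hn Heps.
  destruct (solution_modes sigma mu f g d u Hu)
    as (ut & d1 & y2 & Dd & _ & Dy & Dy1 & Heq).
  destruct (mode_kernel mu sigma n Hs Hm Hn) as (K & K1 & HK & HL & _).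
  set (w := INR n * PI) in *. set (a := damping mu sigma n) in *.
  set (alpha := sine_coef (ut 1) n - w * sigma * d 1). set (beta := sine_coef (u 1) n).
  (* The trace left by the state at time [1], regrouped in terms of the two decaying functions [K]
     and [K1]. *)
  assert (L : is_lim (fun s => (alpha + a * beta) * K s + beta * K1 s) p_infty 0).
  { destruct HK as (_ & _ & _ & _ & L0 & L1).
    replace (Finite 0) with (Finite ((alpha + a * beta) * 0 + beta * 0)) by (f_equal; ring).
    apply is_lim_plus'.
    - apply (is_lim_scal_l K _ p_infty 0 L0).
    - apply (is_lim_scal_l K1 _ p_infty 0 L1). }
  apply is_lim_spec in L. destruct (L (mkposreal eps Heps)) as [T0 HT0]. simpl in HT0.
  exists (Rmax 1 (T0 + 2)). split; [apply Rmax_l|]. intros t Ht.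
  assert (1 <= t) by (eapply Rle_trans; [apply Rmax_l|exact Ht]).
  assert (T0 + 2 <= t) by (eapply Rle_trans; [apply Rmax_r|exact Ht]).
  eapply Rle_trans.
  { apply (duhamel_bound sigma a w M K K1 (fun s => sine_coef (u s) n)
      (fun s => sine_coef (ut s) n) (y2 n) d d1 t HK); auto.
    intros s Hs0. apply HM; lra. }
  specialize (HT0 (t - 1) ltac:(lra)). specialize (HL (t - 1) ltac:(lra)).
  fold alpha beta.
  replace (K (t - 1) * alpha + (K1 (t - 1) + a * K (t - 1)) * beta)
    with ((alpha + a * beta) * K (t - 1) + beta * K1 (t - 1) - 0) by ring.
  assert (HM0 : 0 <= M).
  { pose proof (HM 0 ltac:(lra)). pose proof (Rabs_pos (d 0)). lra. }
  unfold amplitude. fold w.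
  apply (Rmult_le_compat_l M) in HL; [|exact HM0]. lra.
Qed.

(** Unlike the waiting time in [mode_eventually], which varies with the mode, [C] and [N0] serve all
    late modes and all times at once. *)
Lemma mode_uniform :
  exists C N0, (1 <= N0)%nat /\
    forall n t, (N0 <= n)%nat -> 1 <= t -> Rabs (sine_coef (u t) n) <= C / INR n.
Proof.
  destruct (solution_modes sigma mu f g d u Hu)
    as (ut & d1 & y2 & Dd & Cut & Dy & Dy1 & Heq).
  destruct (exists_large_mode sigma Hs) as (N0 & HN0 & Hlarge).
  destruct (continuous_unit_bounded _ (Cut 1 ltac:(lra))) as [C1 HC1].
  destruct (solution_slice sigma mu f g d u 1 Hu ltac:(lra)) as (Cu & ux & Dux & Cux).
  destruct (sine_coef_decay _ _ Dux Cu Cux) as (C2 & HC20 & HC2).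
  (* In order: velocity, boundary value and displacement at time [1], then the forced response. The
     velocity coefficient is merely bounded, but it is multiplied by [|K| <= 2 / a], of order
     [1 / w^2]. *)
  exists (2 * C1 / sigma + 2 * M + 2 * C2 + 3 * M), N0. split; [exact HN0|].
  intros n t Hn Ht. specialize (Hlarge n Hn).
  assert (Hn1 : (1 <= n)%nat) by lia.
  destruct (mode_kernel mu sigma n Hs Hm Hn1) as (K & K1 & HK & HL & Hb).
  destruct (Hb Hlarge) as [Hg Hbt].
  pose proof (mode_frequency_ge n) as Hwn.
  assert (Hn0 : 1 <= INR n) by (apply (le_INR 1); lia).
  eapply Rle_trans.
  { apply (duhamel_bound sigma (damping mu sigma n) (INR n * PI) M K K1
      (fun s => sine_coef (u s) n) (fun s => sine_coef (ut s) n) (y2 n) d d1 t HK); auto.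
    intros s Hs0. apply HM; lra. }
  set (w := INR n * PI) in *.
  assert (Ea : damping mu sigma n = mu + w ^ 2 * sigma) by (unfold w, damping; ring).
  set (a := damping mu sigma n) in *.
  specialize (HL (t - 1) ltac:(lra)). destruct (Hbt (t - 1) ltac:(lra)) as [HKb HK1b].
  set (I := RInt _ 0 (t - 1)) in *.
  pose proof (sine_coef_bound (ut 1) C1 n (Cut 1 ltac:(lra)) HC1) as Hy1.
  pose proof (HC2 n Hn1) as Hy. pose proof (HM 1 ltac:(lra)) as Hd1.
  assert (HM0 : 0 <= M) by (pose proof (Rabs_pos (d 1)); lra).
  assert (HC10 : 0 <= C1) by (pose proof (Rabs_pos (sine_coef (ut 1) n)); lra).
  set (alpha := sine_coef (ut 1) n) in *. set (be := sine_coef (u 1) n) in *.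
  assert (Hwn2 : INR n <= w ^ 2) by nra.
  assert (Hw0 : 0 < w) by lra.
  assert (Haw : w ^ 2 * sigma <= a) by (rewrite Ea; lra).
  assert (Hws : 0 < w ^ 2 * sigma) by nra.
  assert (Hinv : / w <= / INR n) by (apply Rinv_le_contravar; lra).
  assert (Hinv0 : 0 < / w) by (apply Rinv_0_lt_compat; lra).
  assert (B1 : Rabs (K (t - 1) * (alpha - w * sigma * d 1)) <= (2 * C1 / sigma + 2 * M) / INR n).
  { rewrite Rabs_mult.
    assert (Hal : Rabs (alpha - w * sigma * d 1) <= C1 + w * sigma * M).
    { unfold Rminus. eapply Rle_trans; [apply Rabs_triang|]. rewrite Rabs_Ropp, !Rabs_mult.
      rewrite (Rabs_pos_eq w), (Rabs_pos_eq sigma) by lra.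
      assert (w * sigma * Rabs (d 1) <= w * sigma * M) by (apply Rmult_le_compat_l; nra). lra. }
    apply Rle_trans with (2 / (w ^ 2 * sigma) * (C1 + w * sigma * M)).
    - apply Rmult_le_compat; try apply Rabs_pos; [|exact Hal].
      eapply Rle_trans; [exact HKb|]. unfold Rdiv. apply Rmult_le_compat_l; [lra|].
      apply Rinv_le_contravar; lra.
    - replace (2 / (w ^ 2 * sigma) * (C1 + w * sigma * M))
        with (2 * C1 / sigma * / w ^ 2 + 2 * M * / w) by (field; lra).
      unfold Rdiv at 2. rewrite Rmult_plus_distr_r. apply Rplus_le_compat.
      + apply Rmult_le_compat_l; [apply Rdiv_le_0_compat; lra|]. apply Rinv_le_contravar; lra.
      + apply Rmult_le_compat_l; lra. }
  assert (B2 : Rabs ((K1 (t - 1) + a * K (t - 1)) * be) <= 2 * (C2 / INR n)).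
  { rewrite Rabs_mult. apply Rmult_le_compat; try apply Rabs_pos; assumption. }
  assert (B3 : M * I <= 3 * M / INR n).
  { apply Rle_trans with (M * (3 * / INR n)); [|right; unfold Rdiv; ring].
    apply Rmult_le_compat_l; [exact HM0|]. eapply Rle_trans; [exact HL|].
    unfold Rdiv. apply Rle_trans with (3 * / w); [apply Rmult_le_compat_r; lra|lra]. }
  eapply Rle_trans; [apply Rplus_le_compat_r, Rabs_triang|].
  replace ((2 * C1 / sigma + 2 * M + 2 * C2 + 3 * M) / INR n)
    with ((2 * C1 / sigma + 2 * M) / INR n + 2 * (C2 / INR n) + 3 * M / INR n) by (field; lra).
  lra.
Qed.

Lemma sum_modes_eventually (N : nat) (eps : R) :
  0 < eps ->
  exists T, 1 <= T /\ forall t, T <= t ->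
    sum_n (fun n => sine_coef (u t) n ^ 2) N
    <= M ^ 2 * sum_n (fun n => amplitude mu sigma n ^ 2) N + eps.
Proof.
  assert (HM0 : 0 <= M).
  { pose proof (HM 0 ltac:(lra)). pose proof (Rabs_pos (d 0)). lra. }
  revert eps. induction N as [|N IH]; intros eps Heps.
  - exists 1. split; [lra|]. intros t Ht. rewrite !sum_n_O.
    assert (E : sine_coef (u t) 0 = 0).
    { unfold sine_coef. rewrite (RInt_ext _ (fun _ => 0)).
      - rewrite RInt_const. unfold scal; simpl; unfold mult; simpl. ring.
      - intros x _. simpl INR. rewrite Rmult_0_l, Rmult_0_l, sin_0. real_eq. ring. }
    rewrite E. pose proof (pow2_ge_0 (amplitude mu sigma 0)). pose proof (pow2_ge_0 M). nra.
  - destruct (IH (eps / 2) ltac:(lra)) as (T1 & HT1 & H1).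
    set (b := amplitude mu sigma (S N) * M).
    (* Chosen so that [2 * |b| * del + del ^ 2 <= del * (2 * |b| + 1) <= eps / 2]; the cap at [1]
       absorbs the square. *)
    set (del := Rmin 1 (eps / 2 / (2 * Rabs b + 1))).
    pose proof (Rabs_pos b) as Hb0.
    assert (Hq : 0 < eps / 2 / (2 * Rabs b + 1)) by (apply Rdiv_lt_0_compat; lra).
    assert (Hd0 : 0 < del) by (unfold del; apply Rmin_glb_lt; lra).
    assert (Hdel1 : del <= 1) by apply Rmin_l.
    assert (Hdel2 : del * (2 * Rabs b + 1) <= eps / 2).
    { apply Rle_trans with (eps / 2 / (2 * Rabs b + 1) * (2 * Rabs b + 1)).
      - apply Rmult_le_compat_r; [lra|apply Rmin_r].
      - right. field. lra. }
    destruct (mode_eventually (S N) del ltac:(lia) Hd0) as (T2 & HT2 & H2).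
    exists (Rmax T1 T2). split; [eapply Rle_trans; [exact HT1|apply Rmax_l]|].
    intros t Ht. rewrite !sum_n_S.
    specialize (H1 t ltac:(eapply Rle_trans; [apply Rmax_l|exact Ht])).
    specialize (H2 t ltac:(eapply Rle_trans; [apply Rmax_r|exact Ht])). fold b in H2.
    assert (H3 : sine_coef (u t) (S N) ^ 2 <= (b + del) ^ 2).
    { rewrite <- (pow2_abs (sine_coef _ _)). apply pow_incr.
      split; [apply Rabs_pos|exact H2]. }
    assert (Hbb : b <= Rabs b) by apply Rle_abs.
    assert (H4 : (b + del) ^ 2 <= b ^ 2 + eps / 2) by nra.
    assert (E : b ^ 2 = M ^ 2 * amplitude mu sigma (S N) ^ 2) by (unfold b; ring). lra.
Qed.

Lemma energy_eventually (eps : R) :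
  0 < eps ->
  exists T, 1 <= T /\ forall t, T <= t ->
    RInt (fun x => u t x ^ 2) 0 1 <= (G mu sigma * M) ^ 2 + eps.
Proof.
  intros Heps. destruct mode_uniform as (C & N0 & HN0 & HC).
  (* Modes beyond [N] contribute at most [2 * C ^ 2 / N <= eps / 2]; the error of the modes up to
     [N] is [2 * (eps / 4)]. *)
  destruct (INR_unbounded (4 * C ^ 2 / eps)) as [N1 HN1].
  set (N := (N0 + N1)%nat).
  assert (HN : 0 < INR N) by (apply lt_0_INR; unfold N; lia).
  assert (HNC : 2 * (C ^ 2 * / INR N) <= eps / 2).
  { apply (Rmult_le_reg_r (INR N)); [exact HN|].
    replace (2 * (C ^ 2 * / INR N) * INR N) with (2 * C ^ 2) by (field; lra).
    assert (INR N1 <= INR N) by (apply le_INR; unfold N; lia).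
    apply (Rmult_lt_compat_r eps) in HN1; [|lra].
    replace (4 * C ^ 2 / eps * eps) with (4 * C ^ 2) in HN1 by (field; lra). nra. }
  destruct (sum_modes_eventually N (eps / 4) ltac:(lra)) as (T & HT & HS).
  exists T. split; [exact HT|]. intros t Ht.
  destruct (solution_slice sigma mu f g d u t Hu ltac:(lra)) as (Cu & ux & Dux & Cux).
  destruct (continuous_unit_bounded _ Cu) as [F HF].
  destruct (continuous_unit_bounded _ Cux) as [L HL].
  apply (sine_parseval_le (u t) F L HF (lipschitz_of_derive _ _ L Dux Cu HL)).
  intros m.
  apply Rle_trans with (2 * sum_n (fun n => sine_coef (u t) n ^ 2) (N + m)).
  { apply Rmult_le_compat_l; [lra|].
    apply sum_n_nonneg_mono; [intros; apply pow2_ge_0|lia]. }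
  assert (H1 := sum_n_sqr_tail (fun n => sine_coef (u t) n) C N m ltac:(unfold N; lia)
    ltac:(intros n Hn; apply HC; unfold N in Hn; [lia|lra])). cbv beta in H1.
  assert (0 < / INR (N + m)) by (apply Rinv_0_lt_compat, lt_0_INR; unfold N; lia).
  specialize (HS t Ht).
  pose proof (sum_amplitude_le_G mu sigma N Hs Hm) as HG.
  apply (Rmult_le_compat_l (M ^ 2)) in HG; [|apply pow2_ge_0].
  rewrite Rpow_mult_distr. pose proof (pow2_ge_0 C). nra.
Qed.

Lemma norm2_eventually (eps : R) :
  0 < eps ->
  exists T, 1 <= T /\ forall t, T <= t -> norm2 (u t) <= G mu sigma * M + eps.
Proof.
  intros Heps.
  assert (HM0 : 0 <= M).
  { pose proof (HM 0 ltac:(lra)). pose proof (Rabs_pos (d 0)). lra. }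
  pose proof (G_nonneg mu sigma) as HG.
  (* With [G * M] nonnegative, [(G * M) ^ 2 + eps ^ 2 <= (G * M + eps) ^ 2]. *)
  destruct (energy_eventually (eps ^ 2)) as (T & HT & H); [nra|].
  exists T. split; [exact HT|]. intros t Ht. specialize (H t Ht).
  assert (HGM : 0 <= G mu sigma * M) by nra.
  unfold norm2.
  rewrite <- (sqrt_pow2 (G mu sigma * M + eps)) by lra.
  apply sqrt_le_1_alt.
  rewrite (RInt_ext _ (fun x => u t x ^ 2)) by (intros x _; apply pow2_abs).
  eapply Rle_trans; [exact H|]. nra.
Qed.

End Asymptotics.

(** * Limit superior and supremum in the extended reals *)

Lemma limsup_pinfty_le (v : R -> R) (c : R) :
  (forall eps, 0 < eps -> exists T, 0 <= T /\ forall t, T <= t -> v t <= c + eps) ->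
  Rbar_le (limsup_pinfty v) c.
Proof.
  intros H.
  assert (Hle : forall eps, 0 < eps -> Rbar_le (limsup_pinfty v) (c + eps)).
  { intros eps Heps. destruct (H eps Heps) as (T & HT & Hv).
    unfold limsup_pinfty, Rbar_glb.
    destruct (Rbar_ex_glb _) as [l [Hlb Hglb]]. simpl.
    eapply Rbar_le_trans; [apply Hlb; exists T; split; [exact HT|reflexivity]|].
    apply (proj2 (Lub_Rbar_correct _)). intros z (t & Ht & E). rewrite E. now apply Hv. }
  destruct (limsup_pinfty v) as [l| |].
  - simpl. apply le_epsilon. exact Hle.
  - exact (Hle 1 ltac:(lra)).
  - exact I.
Qed.

(** Finiteness reduces the final [Rbar_mult] to a product of reals. The value at [t = 0] rules out
    [m_infty]. *)
Lemma sup_half_line_bounded (v : R -> R) (M : R) :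
  (forall t, 0 <= t -> v t <= M) ->
  exists D, sup_half_line v = Finite D /\ forall t, 0 <= t -> v t <= D.
Proof.
  intros HM. unfold sup_half_line.
  destruct (Lub_Rbar_correct (fun z => exists t, 0 <= t /\ z = v t)) as [Hub Hlub].
  assert (Hle : Rbar_le (Lub_Rbar (fun z => exists t, 0 <= t /\ z = v t)) M).
  { apply Hlub. intros z (t & Ht & E). rewrite E. now apply HM. }
  assert (Hge : forall t, 0 <= t ->
            Rbar_le (v t) (Lub_Rbar (fun z => exists t, 0 <= t /\ z = v t))).
  { intros t Ht. apply Hub. now exists t. }
  destruct (Lub_Rbar _) as [D| |].
  - exists D. split; [reflexivity|exact Hge].
  - destruct Hle.
  - destruct (Hge 0 ltac:(lra)).
Qed.

Theorem theorem3p1 :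
  forall sigma mu : R, 0 < sigma -> 0 <= mu ->
  exists gamma : R, 0 <= gamma /\ gamma <= G mu sigma /\
    forall f g d : R -> R,
      X_set sigma mu f g -> Phi_set sigma mu f g d ->
      forall u : R -> R -> R, is_solution sigma mu f g d u ->
        Rbar_le (limsup_pinfty (fun t => norm2 (u t)))
                (Rbar_mult (Finite gamma) (sup_half_line (fun t => Rabs (d t)))).
Proof.
  intros sigma mu Hs Hm.
  exists (G mu sigma). split; [apply G_nonneg|]. split; [lra|].
  intros f g d _ ((_ & M & HM) & _) u Hu.
  (* The given bound [M] makes the supremum [D] finite; the asymptotic estimate is then applied with
     [D] itself, which yields the sharp right-hand side. *)
  destruct (sup_half_line_bounded (fun t => Rabs (d t)) M HM) as (D & -> & HD).
  simpl. apply limsup_pinfty_le. intros eps Heps.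
  destruct (norm2_eventually sigma mu D f g d u Hs Hm HD Hu eps Heps) as (T & HT & H).
  exists T. split; [lra|exact H].
Qed.
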